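(* Let $v$ be a generic Gelfand--Tsetlin tableau of height $n$ satisfying the standing conventions (A) and (B) of the context, and let $\overline V(T(v))=\mathrm U_q(T(v))\big/\sum_{1\le j\le k\le n-1}W_{kj}$ for a choice of the submodules $W_{kj}$ as described in the context. Then the $\mathrm U_q$-module $\overline V(T(v))$ is simple if and only if the following holds: for any $i\in\{1,\dots,n\}$ and $j\in\{1,\dots,n-1\}$ with $W_{n-1,j}=W_{n-1,j}^{(2)}$, if $v_{n,i}-v_{n-1,j}\in\mathbb Z$, then $v_{n,i}-v_{n-1,j}\equiv0 \pmod m$.
   Context: Let $n\ge2$, $m\ge3$ odd, $\theta=2\pi/m$, $q=e^{\mathbf i\theta}$, $\mathbf i=\sqrt{-1}$. For $x\in\mathbb C$: $q^x=e^{\mathbf i\theta x}$, $[x]_q=\frac{q^x-q^{-x}}{q-q^{-1}}$. $\mathrm U_q=\mathrm U_q(\mathfrak{gl}_n)$ is the unital associative $\mathbb C$-algebra generated by $E_i,F_i$ ($1\le i\le n-1$), $K_j^{\pm1}$ ($1\le j\le n$) with relations: the $K_j$ commute and are invertible; $K_iE_jK_i^{-1}=q^{\delta_{ij}-\delta_{i,j+1}}E_j$; $K_iF_jK_i^{-1}=q^{\delta_{i,j+1}-\delta_{ij}}F_j$; $[E_i,F_j]=\delta_{ij}\frac{K_iK_{i+1}^{-1}-K_{i+1}K_i^{-1}}{q-q^{-1}}$; $[E_i,E_j]=[F_i,F_j]=0$ for $|i-j|\ge2$; $E_i^2E_{i\pm1}-(q+q^{-1})E_iE_{i\pm1}E_i+E_{i\pm1}E_i^2=0$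 and the same with $F$. A Gelfand--Tsetlin tableau of height $n$ is an array $v=(v_{ij})_{1\le j\le i\le n}$ of complex numbers; $\delta^{ij}$ is the array with $1$ at $(i,j)$ and $0$ elsewhere. $v$ is generic if $v_{ki}-v_{kj}\notin\frac{\mathbb Z}{2}$ for all $1\le k\le n-1$, $i\ne j$. Standing conventions: (A) for all positions $(a,b),(i,j)$, either $v_{ab}-v_{ij}\in\mathbb Z$ or $v_{ab}-v_{ij}\notin\frac{\mathbb Z}{2}$. (B) For $2\le k\le n-1$: if $\{j\mid v_{k,j}-v_{k-1,i}\in\mathbb Z\}\ne\emptyset$, then this set is $\{i\}$ and $v_{k,i}=v_{k-1,i}$; for $k=n$: if $\{j\mid v_{n,j}-v_{n-1,i}\in\mathbb Z\}\neq\emptyset$ (several such $j$ are allowed), then $v_{n,i}=v_{n-1,i}$. $V(T(v))$ is the vector space with basis the symbols $T(v+z)$, $z=(z_{ij})_{1\le j\le i\le n}$ an integer array with $z_{ni}=0$ for all $i$, made a $\mathrm U_q$-module by the Gelfand--Tsetlin formulae: for $w=v+z$, $K_kT(w)=q^{a_k}T(w)$, $a_k=\sum_{i=1}^kw_{k,i}-\sum_{i=1}^{k-1}w_{k-1,i}+k$; $E_kT(w)=-\sum_{j=1}^k\frac{\prod_{i=1}^{k+1}[w_{k,j}-w_{k+1,i}]_q}{\prod_{i\ne j}[w_{k,j}-w_{k,i}]_q}T(w+\delta^{kj})$; $F_kT(w)=\sum_{j=1}^k\frac{\prod_{i=1}^{k-1}[w_{k,j}-w_{k-1,i}]_q}{\prod_{i\ne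 j}[w_{k,j}-w_{k,i}]_q}T(w-\delta^{kj})$. $\mathrm U_q(T(v))$ is the submodule generated by $T(v)$. For $1\le j\le k\le n-1$, let $t$ ($j\le t\le k$) be determined by $v_{kj}=v_{k-1,j}=\dots=v_{tj}\ne v_{t-1,j}$ (with $t=j$ if all of $v_{kj},\dots,v_{jj}$ are equal). $W_{kj}^{(1)}$ is the submodule of $\mathrm U_q(T(v))$ generated by $T(v-m\delta^{kj}-m\delta^{k-1,j}-\dots-m\delta^{tj})-T(v)$; $W_{kj}^{(2)}$ is the submodule generated by $T(v-m\delta^{kj}-m\delta^{k-1,j}-\dots-m\delta^{tj})$. If $v_{k+1,j}\ne v_{kj}$, then $W_{kj}=W_{kj}^{(1)}$. If $v_{k+1,j}=v_{kj}$, then $W_{kj}$ is chosen to be either $W_{kj}^{(1)}$ or $W_{kj}^{(2)}$. *)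

(* Defs.v *)
From HB Require Import structures.
From mathcomp Require Import all_boot all_order all_algebra.
From mathcomp Require Import generic_quotient ring_quotient complex monalg.
From mathcomp Require Import all_classical all_reals sequences trigo.

Set Implicit Arguments.
Unset Strict Implicit.
Unset Printing Implicit Defensive.

Import Order.TTheory GRing.Theory Num.Theory.
Local Open Scope classical_set_scope.
Local Open Scope ring_scope.
Local Open Scope quotient_scope.

Section Submodules.
Variables (A : pzRingType) (V : lmodType A).

Definition is_submod (S : set V) : Prop :=
  S 0 /\ forall a u v, S u -> S v -> S (a *: u + v).

Record submod := Submod {
  submod_set :> set V;
  submodP : is_submod submod_set }.

Lemma submod_span_subproof (X : set V) : is_submod (smallest is_submod X).
Proof.
split=> [S [[]] //|a u v uS vS S SX].
by have [[_ +] _] := SX; apply; [exact: uS | exact: vS].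
Qed.
Definition submod_span (X : set V) : submod := Submod (submod_span_subproof X).

Lemma zerosm_subproof : is_submod [set 0 : V].
Proof. by split=> // a _ _ -> ->; rewrite scaler0 addr0. Qed.
Definition zerosm : submod := Submod zerosm_subproof.

Lemma addsm_subproof (M N : submod) :
  is_submod [set x + y | x in M & y in N].
Proof.
have [M0 MD] := submodP M; have [N0 ND] := submodP N.
split=> [|a _ _ [u Mu [v Nv <-]] [u' Mu' [v' Nv' <-]]].
  by exists 0 => //; exists 0 => //; rewrite addr0.
exists (a *: u + u'); first exact: MD.
exists (a *: v + v'); first exact: ND.
by rewrite scalerDr addrACA.
Qed.
Definition addsm (M N : submod) : submod := Submod (addsm_subproof M N).

Definition submod_pred (S : submod) : {pred V} := fun x => x \in submod_set S.

Lemma submod_pred_closed (S : submod) : GRing.submod_closed (submod_pred S).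
Proof.
have [S0 SD] := submodP S.
split=> [|a u v /set_mem Su /set_mem Sv]; apply/mem_set => //; exact: SD.
Qed.

HB.instance Definition _ (S : submod) :=
  GRing.isSubmodClosed.Build A V (submod_pred S)
    (GRing.submod_closed_semi (submod_pred_closed S)).

Definition submod_type (S : submod) := {x : V | x \in submod_pred S}.
HB.instance Definition _ S := [isSub of submod_type S for sval].
HB.instance Definition _ S := [Choice of submod_type S by <:].
HB.instance Definition _ S := [SubChoice_isSubLmodule of submod_type S by <:].

Definition quot_mod (N : submod) := Quotient.quot (submod_pred N).
HB.instance Definition _ N := GRing.Zmodule.on (quot_mod N).

Section QuotientModule.
Variable N : submod.
Implicit Types (a b : A) (x y : quot_mod N).

Let pi_eq (u v : V) :
  (\pi_(quot_mod N) u == \pi_(quot_mod N) v) = (u - v \in submod_pred N).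
Proof. exact/esym/Quotient.idealrBE. Qed.

Definition quot_scale a x : quot_mod N := \pi_(quot_mod N) (a *: repr x).

Lemma quot_scale_pi a u : quot_scale a (\pi u) = \pi_(quot_mod N) (a *: u).
Proof.
apply/eqP; rewrite pi_eq -scalerBr rpredZ // -pi_eq; apply/eqP; exact: reprK.
Qed.

Let pi_add (u v : V) : \pi_(quot_mod N) (u + v) = \pi u + \pi v.
Proof. exact: Quotient.pi_add. Qed.

Lemma quot_scaleA a b x : quot_scale a (quot_scale b x) = quot_scale (a * b) x.
Proof. by rewrite [quot_scale b x]/quot_scale quot_scale_pi scalerA. Qed.

Lemma quot_scale1 : left_id 1 quot_scale.
Proof. by move=> x; rewrite /quot_scale scale1r reprK. Qed.

Lemma quot_scaleDr : right_distributive quot_scale +%R.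
Proof.
move=> a x y; rewrite -[x]reprK -[y]reprK -pi_add !quot_scale_pi.
by rewrite scalerDr pi_add.
Qed.

Lemma quot_scaleDl x : {morph quot_scale^~ x : a b / a + b}.
Proof. by move=> a b; rewrite /quot_scale scalerDl pi_add. Qed.

HB.instance Definition _ := GRing.Zmodule_isLmodule.Build A (quot_mod N)
  quot_scaleA quot_scale1 quot_scaleDr quot_scaleDl.
End QuotientModule.

End Submodules.

Section Subquotient.
Variables (A : pzRingType) (V : lmodType A) (M N : submod V).

Lemma restrict_subproof :
  is_submod [set x : submod_type M | submod_set N (val x)].
Proof.
have [N0 ND] := submodP N.
split=> [|a u v Nu Nv]; rewrite /mkset; first by rewrite raddf0.
by rewrite linearP; exact: ND.
Qed.
Definition restrict_submod : submod (submod_type M) := Submod restrict_subproof.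

(* M / N for N contained in M; in general M / (M :&: N). *)
Definition subquot : lmodType A := quot_mod restrict_submod.
End Subquotient.

Definition simple_module (A : pzRingType) (V : lmodType A) : Prop :=
  (exists x : V, x != 0) /\
  forall S : submod V, S = [set 0] :> set V \/ S = [set: V] :> set V.

Section PresentedAlgebra.
Variables (K : comNzRingType) (X : choiceType).
Local Notation free := {malg K[{fmonom X}]}.
Variable rel : free -> free -> Prop.

Definition is_ideal (I : set free) : Prop :=
  [/\ I 0, forall x y, I x -> I y -> I (x - y)
    & forall a x, I x -> I (a * x) /\ I (x * a)].

Definition rel_ideal : set free :=
  smallest is_ideal [set x | exists2 p, rel p.1 p.2 & x = p.1 - p.2].

Lemma rel_idealP : is_ideal rel_ideal.
Proof.
split=> [I [[]] //|x y Ix Iy I IP|a x Ix].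
  by have [[_ + _] _] := IP; apply; [exact: Ix | exact: Iy].
by split=> I IP; have [[_ _ +] _] := IP; move=> /(_ a x (Ix _ IP)) [].
Qed.

Definition ideal_pred : {pred free} := fun x => x \in rel_ideal.

Lemma ideal_pred_closed : GRing.zmod_closed ideal_pred.
Proof.
have [I0 IB _] := rel_idealP.
by split=> [|x y /set_mem Ix /set_mem Iy]; apply/mem_set => //; exact: IB.
Qed.
HB.instance Definition _ := GRing.isZmodClosed.Build free ideal_pred
  ideal_pred_closed.

Definition pres_alg := Quotient.quot ideal_pred.
HB.instance Definition _ := GRing.Zmodule.on pres_alg.

Definition pres_pi (x : free) : pres_alg := \pi_pres_alg x.
Definition pres_const (c : K) : pres_alg := pres_pi c%:MP.
Definition pres_gen (g : X) : pres_alg := pres_pi << fmu g >>.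

Local Notation pi := pres_pi.
Implicit Types (x y z : pres_alg) (a b : free).

Let pi_repr x : pi (repr x) = x. Proof. exact: reprK. Qed.

Let pi_eqP a b : (pi a == pi b) = (a - b \in ideal_pred).
Proof. exact/esym/Quotient.idealrBE. Qed.

Lemma pres_pi_rel a b : rel a b -> pi a = pi b.
Proof.
move=> ab; apply/eqP; rewrite pi_eqP; apply/mem_set => I [_].
by apply; exists (a, b).
Qed.

Let pi_add a b : pi (a + b) = pi a + pi b.
Proof. exact: Quotient.pi_add. Qed.

Let idealM a b c d : a - b \in ideal_pred -> c - d \in ideal_pred ->
  a * c - b * d \in ideal_pred.
Proof.
have [_ _ IM] := rel_idealP.
move=> /set_mem ab /set_mem cd.
rewrite -[a * c](subrK (b * c)) -addrA -mulrBl -mulrBr.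
by apply: rpredD; apply/mem_set; [have [] := IM c _ ab | have [] := IM b _ cd].
Qed.

Definition pres_mul x y := pi (repr x * repr y).
Definition pres_scale (c : K) x := pi (c *: repr x).

Let pi_mul a b : pres_mul (pi a) (pi b) = pi (a * b).
Proof. by apply/eqP; rewrite pi_eqP; apply: idealM; rewrite -pi_eqP pi_repr. Qed.

Let pi_scale c a : pres_scale c (pi a) = pi (c *: a).
Proof.
apply/eqP; rewrite pi_eqP -!mul_malgC.
by apply: idealM; rewrite ?subrr ?rpred0 // -pi_eqP pi_repr.
Qed.

Lemma pres_mulA : associative pres_mul.
Proof.
by move=> x y z; rewrite -[x]pi_repr -[y]pi_repr -[z]pi_repr !pi_mul mulrA.
Qed.
Lemma pres_mul1 : left_id (pi 1) pres_mul.
Proof. by move=> x; rewrite -[x]pi_repr pi_mul mul1r. Qed.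
Lemma pres_mulr1 : right_id (pi 1) pres_mul.
Proof. by move=> x; rewrite -[x]pi_repr pi_mul mulr1. Qed.
Lemma pres_mulDl : left_distributive pres_mul +%R.
Proof.
move=> x y z; rewrite -[x]pi_repr -[y]pi_repr -[z]pi_repr -pi_add !pi_mul.
by rewrite mulrDl pi_add.
Qed.
Lemma pres_mulDr : right_distributive pres_mul +%R.
Proof.
move=> x y z; rewrite -[x]pi_repr -[y]pi_repr -[z]pi_repr -pi_add !pi_mul.
by rewrite mulrDr pi_add.
Qed.
HB.instance Definition _ := GRing.Zmodule_isPzRing.Build pres_alg
  pres_mulA pres_mul1 pres_mulr1 pres_mulDl pres_mulDr.

Lemma pres_scaleA c d x :
  pres_scale c (pres_scale d x) = pres_scale (c * d) x.
Proof. by rewrite -[x]pi_repr !pi_scale scalerA. Qed.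
Lemma pres_scale1 : left_id 1 pres_scale.
Proof. by move=> x; rewrite -[x]pi_repr pi_scale scale1r. Qed.
Lemma pres_scaleDr : right_distributive pres_scale +%R.
Proof.
move=> c x y; rewrite -[x]pi_repr -[y]pi_repr -pi_add !pi_scale.
by rewrite scalerDr pi_add.
Qed.
Lemma pres_scaleDl x : {morph pres_scale^~ x : c d / c + d}.
Proof. by move=> c d; rewrite -[x]pi_repr !pi_scale scalerDl pi_add. Qed.
HB.instance Definition _ := GRing.Zmodule_isLmodule.Build K pres_alg
  pres_scaleA pres_scale1 pres_scaleDr pres_scaleDl.

(* The library's algebra structures require 1 != 0, which a presented algebra
   need not satisfy; the compatibility of the scalars with the product is
   therefore given by the next lemmas. *)
Lemma pres_scaleAl c x y : c *: (x * y) = c *: x * y.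
Proof.
change (pres_scale c (pres_mul x y) = pres_mul (pres_scale c x) y).
rewrite -[x]pi_repr -[y]pi_repr !(pi_mul, pi_scale).
by rewrite scalerAl.
Qed.

Lemma free_scaleAr (c : K) a b : c *: (a * b) = a * (c *: b).
Proof.
have mulC d : d * c%:MP = c *: d.
  rewrite malgM_def malgZ_def fgmulgU; apply/eq_bigr => k _.
  by rewrite mulm1 mulrC.
by rewrite -mulC -mulrA mulC.
Qed.
Lemma pres_scaleAr c x y : c *: (x * y) = x * (c *: y).
Proof.
change (pres_scale c (pres_mul x y) = pres_mul x (pres_scale c y)).
rewrite -[x]pi_repr -[y]pi_repr !(pi_mul, pi_scale).
by rewrite free_scaleAr.
Qed.
Lemma pres_constE c : pres_const c = pres_scale c 1.
Proof. by rewrite pi_scale -mul_malgC mulr1. Qed.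
End PresentedAlgebra.

Section ScalarsOfModule.
Variables (K : comNzRingType) (X : choiceType).
Variable rel : {malg K[{fmonom X}]} -> {malg K[{fmonom X}]} -> Prop.
Variable V : lmodType (pres_alg rel).

Definition kscale (c : K) (x : V) : V := pres_const rel c *: x.

Definition is_kbasis (I : eqType) (P : set I) (b : I -> V) : Prop :=
  (forall x : V, exists (s : seq I) (c : I -> K),
     (forall i, i \in s -> P i) /\ x = \sum_(i <- s) kscale (c i) (b i)) /\
  (forall (s : seq I) (c : I -> K),
     uniq s -> (forall i, i \in s -> P i) ->
     \sum_(i <- s) kscale (c i) (b i) = 0 -> forall i, i \in s -> c i = 0).
End ScalarsOfModule.

(* Ordinals count from 0: [GE i], [GF i], [GK i] and [GKinv i] stand for
   E_(i+1), F_(i+1), K_(i+1) and its inverse. *)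
Inductive Uq_gen (n : nat) : Type :=
| GE of 'I_n.-1
| GF of 'I_n.-1
| GK of 'I_n
| GKinv of 'I_n.

HB.instance Definition _ n := gen_eqMixin (Uq_gen n).
HB.instance Definition _ n := gen_choiceMixin (Uq_gen n).

Section QuantumGroup.
Variables (K : fieldType) (n : nat) (q : K).
Local Notation free := {malg K[{fmonom (Uq_gen n)}]}.
Local Notation E i := (<< fmu (GE i) >> : free).
Local Notation F i := (<< fmu (GF i) >> : free).
Local Notation K_ j := (<< fmu (GK j) >> : free).
Local Notation Kinv j := (<< fmu (GKinv j) >> : free).
Local Notation d i j := (nat_of_bool (i == j :> nat))%:Z.

Definition adjacent (i j : nat) : bool := (i.+1 == j) || (j.+1 == i).
Definition distant (i j : nat) : bool := (i.+1 < j)%N || (j.+1 < i)%N.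

Inductive Uq_rel : free -> free -> Prop :=
| rel_KK (i j : 'I_n) : Uq_rel (K_ i * K_ j) (K_ j * K_ i)
| rel_KKinv (j : 'I_n) : Uq_rel (K_ j * Kinv j) 1
| rel_KinvK (j : 'I_n) : Uq_rel (Kinv j * K_ j) 1
| rel_KE (i : 'I_n) (j : 'I_n.-1) :
    Uq_rel (K_ i * E j * Kinv i) (q ^ (d i j - d i j.+1) *: E j)
| rel_KF (i : 'I_n) (j : 'I_n.-1) :
    Uq_rel (K_ i * F j * Kinv i) (q ^ (d i j.+1 - d i j) *: F j)
| rel_EF (i : 'I_n.-1) (a b : 'I_n) : a = i :> nat -> b = i.+1 :> nat ->
    Uq_rel (E i * F i - F i * E i)
           ((q - q^-1)^-1 *: (K_ a * Kinv b - K_ b * Kinv a))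
| rel_EF0 (i j : 'I_n.-1) : i != j -> Uq_rel (E i * F j - F j * E i) 0
| rel_EE (i j : 'I_n.-1) : distant i j -> Uq_rel (E i * E j - E j * E i) 0
| rel_FF (i j : 'I_n.-1) : distant i j -> Uq_rel (F i * F j - F j * F i) 0
| rel_serreE (i j : 'I_n.-1) : adjacent i j ->
    Uq_rel (E i ^+ 2 * E j - (q + q^-1) *: (E i * E j * E i) + E j * E i ^+ 2) 0
| rel_serreF (i j : 'I_n.-1) : adjacent i j ->
    Uq_rel (F i ^+ 2 * F j - (q + q^-1) *: (F i * F j * F i) + F j * F i ^+ 2) 0.

Definition Uq : Type := pres_alg Uq_rel.
HB.instance Definition _ := GRing.PzRing.on Uq.
HB.instance Definition _ := GRing.Lmodule.on Uq.

Definition UE (i : 'I_n.-1) : Uq := pres_gen Uq_rel (GE i).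
Definition UF (i : 'I_n.-1) : Uq := pres_gen Uq_rel (GF i).
Definition UK (j : 'I_n) : Uq := pres_gen Uq_rel (GK j).
Definition UKinv (j : 'I_n) : Uq := pres_gen Uq_rel (GKinv j).
End QuantumGroup.

Section QNumbers.
Variables (R : realType) (m : nat).
Local Open Scope complex_scope.

Definition cexp (z : R[i]) : R[i] :=
  let: a +i* b := z in (expR a * cos b) +i* (expR a * sin b).

Definition theta : R := 2 * pi / m%:R.

Definition qpow (x : R[i]) : R[i] := cexp ((0 +i* theta) * x).

Definition qroot : R[i] := cexp (0 +i* theta).

Definition qnum (x : R[i]) : R[i] :=
  (qpow x - qpow (- x)) / (qroot - qroot^-1).
End QNumbers.

(* Arrays are functions of the row and the column, both counted from 1; only
   the entries at positions 1 <= j <= i <= n are ever read. *)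
Section Tableaux.
Variable R : realType.
Local Notation C := R[i].
Local Notation tableau := (nat -> nat -> C).
Local Notation array := (nat -> nat -> int).

Definition position (n i j : nat) : Prop := (1 <= j <= i)%N /\ (i <= n)%N.

Definition is_int (x : C) : Prop := exists a : int, x = a%:~R.
Definition is_half_int (x : C) : Prop := exists a : int, x = a%:~R / 2.

Definition generic (n : nat) (v : tableau) : Prop :=
  forall k i j, position n.-1 k i -> position n.-1 k j -> i != j ->
    ~ is_half_int (v k i - v k j).

Definition conventionA (n : nat) (v : tableau) : Prop :=
  forall a b i j, position n a b -> position n i j ->
    is_int (v a b - v i j) \/ ~ is_half_int (v a b - v i j).

Definition int_links (v : tableau) (k i : nat) : set nat :=
  [set j | (1 <= j <= k)%N /\ is_int (v k j - v k.-1 i)].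

Definition conventionB (n : nat) (v : tableau) : Prop :=
  (forall k i, (2 <= k <= n.-1)%N -> (1 <= i <= k.-1)%N ->
     int_links v k i !=set0 ->
     int_links v k i = [set i] /\ v k i = v k.-1 i) /\
  (forall i, (1 <= i <= n.-1)%N ->
     int_links v n i !=set0 -> v n i = v n.-1 i).

Definition delta (i j : nat) : array :=
  fun a b => ((a == i) && (b == j))%:Z.

(* The integer arrays z indexing the basis T(v + z): triangular, with zero
   n-th row. *)
Definition int_shift (n : nat) : set array :=
  [set z | forall i j, ~ position n.-1 i j -> z i j = 0].

Definition translate (v : tableau) (z : array) : tableau :=
  fun i j => v i j + (z i j)%:~R.

(* The row t with v k j = v (k-1) j = ... = v t j != v (t-1) j, and t = j if
   there is no such row above row j. *)
Fixpoint chain_bottom (v : tableau) (k j : nat) : nat :=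
  if k is k'.+1 then
    if (j <= k')%N && (v k j == v k' j) then chain_bottom v k' j else k
  else 0%N.

Lemma chain_bottomP v k j : (1 <= j <= k)%N ->
  let t := chain_bottom v k j in
  [/\ (j <= t <= k)%N, forall l, (t <= l <= k)%N -> v l j = v k j
    & t = j \/ v t.-1 j <> v t j].
Proof.
move=> /andP[j1]; elim: k => [|k IH] /=; first by rewrite leqNgt j1.
move=> jk; case: ifPn => [/andP[jk' /eqP e]|].
  have [/andP[-> tk] tl tj] := IH jk'.
  split => //; first by rewrite leqW.
  move=> l /andP[tl']; rewrite leq_eqVlt ltnS => /orP[/eqP-> //|lk].
  by rewrite tl ?tl'.
move=> h; split; first by rewrite jk /=.
  by move=> l; rewrite -eqn_leq => /eqP <-.
move: h; rewrite negb_and -ltnNge => /orP[kj|/eqP ne]; last by right=> /esym.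
by left; apply/eqP; rewrite eqn_leq kj jk.
Qed.

(* - m (delta^kj + delta^(k-1,j) + ... + delta^tj), t = chain_bottom v k j *)
Definition chain_drop (m : nat) (v : tableau) (k j : nat) : array :=
  fun a b => - (m%:Z * \sum_(chain_bottom v k j <= l < k.+1) delta l j a b).

Variables (n m : nat).
Local Notation "[ x ]_q" := (qnum m x) (at level 0, format "[ x ]_q").

Definition weight (w : tableau) (k : nat) : C :=
  \sum_(1 <= i < k.+1) w k i - \sum_(1 <= i < k) w k.-1 i + k%:R.

Definition coefE (w : tableau) (k j : nat) : C :=
  - ((\prod_(1 <= i < k.+2) [w k j - w k.+1 i]_q) /
     (\prod_(1 <= i < k.+1 | i != j) [w k j - w k i]_q)).

Definition coefF (w : tableau) (k j : nat) : C :=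
  (\prod_(1 <= i < k) [w k j - w k.-1 i]_q) /
  (\prod_(1 <= i < k.+1 | i != j) [w k j - w k i]_q).

(* V is the Gelfand-Tsetlin module V(T(v)), and T z is its basis vector
   T(v + z) for every z in [int_shift n]; T is irrelevant elsewhere. *)
Record is_GT_module (v : tableau) (V : lmodType (Uq n (qroot R m)))
    (T : array -> V) : Prop := IsGTModule {
  GT_basis : is_kbasis (int_shift n) T;
  GT_K : forall z (k : 'I_n), int_shift n z ->
    UK (qroot R m) k *: T z =
      kscale (qpow m (weight (translate v z) k.+1)) (T z);
  GT_E : forall z (k : 'I_n.-1), int_shift n z ->
    UE (qroot R m) k *: T z =
      \sum_(1 <= j < k.+2)
        kscale (coefE (translate v z) k.+1 j) (T (z + delta k.+1 j));
  GT_F : forall z (k : 'I_n.-1), int_shift n z ->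
    UF (qroot R m) k *: T z =
      \sum_(1 <= j < k.+2)
        kscale (coefF (translate v z) k.+1 j) (T (z - delta k.+1 j)) }.

Section QuotientOfCyclicModule.
Variables (v : tableau) (V : lmodType (Uq n (qroot R m))) (T : array -> V).

Definition UqT : submod V := submod_span [set T 0].

Definition W1 (k j : nat) : submod V :=
  submod_span [set T (chain_drop m v k j) - T 0].

Definition W2 (k j : nat) : submod V := submod_span [set T (chain_drop m v k j)].

Definition W_choice (W : nat -> nat -> submod V) : Prop :=
  forall k j, position n.-1 k j ->
    (v k.+1 j <> v k j -> W k j = W1 k j) /\
    (v k.+1 j = v k j -> W k j = W1 k j \/ W k j = W2 k j).

Definition sumW (W : nat -> nat -> submod V) : submod V :=
  \big[@addsm _ V/@zerosm _ V]_(1 <= k < n)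
    \big[@addsm _ V/@zerosm _ V]_(1 <= j < k.+1) W k j.

Definition Vbar (W : nat -> nat -> submod V) : lmodType (Uq n (qroot R m)) :=
  subquot UqT (sumW W).
End QuotientOfCyclicModule.
End Tableaux.

(* Main.v *)
From mathcomp Require Import all_boot all_order all_algebra complex.
From mathcomp Require Import generic_quotient ring_quotient monalg.
From mathcomp Require Import all_classical all_reals sequences exp trigo.
From mathcomp Require Import ring lra zify.
(* After the libraries, so that coefE is not the one of poly. *)
Require Import Defs.

Set Implicit Arguments.
Unset Strict Implicit.
Unset Printing Implicit Defensive.

Import Order.TTheory GRing.Theory Num.Theory.
Local Open Scope ring_scope.

(** Write w = v+z.  The coefficients of the Gelfand-Tsetlin formulae depend on the
array z only modulo m, so T(v+z) |-> T(v+z+md) commutes with the action.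

The algebra separates the residues of z mod m: by induction on k it contains the
projections onto the classes of rows 1..k.  Given those up to row k, E_k and F_k
split into single arrows z -> z +- delta^kj, and at least one of the loops F E, E F
at (k,j) is a nonzero multiple of the value of prod_i (X - q^(2w_(k+1,i))) at
q^(2w_kj) or q^(2(w_kj-1)), because w_kj and w_kj+1 are not both congruent to
w_(k-1,j).  With the constant term, which K_(k+1) provides, these k+1 values
determine that monic polynomial of degree k+1, hence row k+1 mod m.

A submodule is therefore governed by the graph of nonvanishing arrows.  In each
column use as coordinates the heights: z_(k+1,j) - z_kj if v_(k+1,j) = v_kj, and
-z_kj otherwise.  Then U_q(T(v)) is spanned by the T(v+z) whose heights at linked
positions are nonnegative; lowering by one the chain of (k,j) raises the height
there by one and changes no other; W^(1) identifies heights differing by m and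
W^(2) kills the heights >= m.  From any class one reaches T(v) by clearing the
heights row by row, raising at killed positions and lowering at the others.  This
is obstructed exactly when a killed position of row n-1 has a second barrier, at
height -d mod m, coming from some v_ni = v_(n-1,j) + d with m not dividing d; the
heights above the barrier then span a proper submodule. *)

Local Notation array := (nat -> nat -> int).

(** * The q-exponential *)

Lemma sin_pi_int (R : realType) (a : int) : sin (pi * a%:~R) = 0 :> R.
Proof.
have sinn n : sin (pi * n%:R) = 0 :> R.
  by elim: n => [|n IH]; rewrite ?mulr0 ?sin0 // mulr_natr mulrSr -mulr_natr
    sinDpi IH oppr0.
case: a => n; first exact: sinn.
by rewrite NegzE mulrNz mulrN sinN sinn oppr0.
Qed.

(** The duplication formula gives sin(x/2) = 0. After subtraction of a multiple of pi, x/2 falls in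
    [0, pi), where the sine vanishes only at 0. *)
Lemma cos_eq1 (R : realType) (x : R) :
  cos x = 1 -> exists a : int, x = pi *+ 2 * a%:~R.
Proof.
move=> cx; have pi0 := @pi_gt0 R.
have sx : sin (x / 2) = 0.
  have : cos ((x / 2) *+ 2) = 1 by rewrite -mulr_natr divfK ?pnatr_eq0.
  rewrite cos_mulr2n cos2sin2 => e; apply/eqP; rewrite -sqrf_eq0; apply/eqP.
  lra.
set a := Num.floor (x / 2 / pi); exists a.
have /andP[ale] := Num.Theory.floor_itv (x / 2 / pi).
rewrite -/a in ale *; rewrite intrD => alt.
have sz : sin (x / 2 - pi * a%:~R) = 0.
  by rewrite sinB sx sin_pi_int mul0r mulr0 subrr.
suff : x / 2 - pi * a%:~R = 0 by rewrite -mulr_natr => ?; lra.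
apply/eqP; apply/contraPT: sz => nz; apply/eqP.
rewrite gt_eqF // sin_gt0_pi // lt_neqAle eq_sym nz subr_ge0 /=.
by rewrite mulrC -ler_pdivlMr // ale /= ltrBlDl -[X in _ + X]mul1r -mulrDl
  -ltr_pdivrMr.
Qed.

Section QPow.
Variables (R : realType) (m : nat).
Local Open Scope complex_scope.
Implicit Types x y : R[i].

Lemma cexpD x y : cexp (x + y) = cexp x * cexp y.
Proof.
case: x y => [a b] [c d]; rewrite /cexp /= expRD cosD sinD.
by apply/eqP; rewrite eq_complex /=; apply/andP; split; apply/eqP; ring.
Qed.

Lemma cexp0 : cexp (0 : R[i]) = 1.
Proof. by rewrite /cexp /= expR0 cos0 sin0 !mul1r. Qed.

Lemma qpowD x y : qpow m (x + y) = qpow m x * qpow m y.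
Proof. by rewrite /qpow mulrDr cexpD. Qed.

Lemma qpow0 : qpow m (0 : R[i]) = 1.
Proof. by rewrite /qpow mulr0 cexp0. Qed.

Lemma qpow_neq0 x : qpow m x != 0.
Proof.
have : qpow m x * qpow m (- x) != 0 by rewrite -qpowD subrr qpow0 oner_eq0.
by rewrite mulf_eq0 negb_or => /andP[].
Qed.

Lemma qpowN x : qpow m (- x) = (qpow m x)^-1.
Proof. by apply: (mulfI (qpow_neq0 x)); rewrite divff ?qpow_neq0 // -qpowD
  subrr qpow0. Qed.

Lemma qpow_sum (I : Type) (r : seq I) (P : pred I) (F : I -> R[i]) :
  qpow m (\sum_(i <- r | P i) F i) = \prod_(i <- r | P i) qpow m (F i).
Proof. exact: (big_morph _ qpowD qpow0). Qed.

Lemma qrootE : qroot R m = qpow m 1.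
Proof. by rewrite /qpow mulr1. Qed.

Hypothesis m_gt2 : (2 < m)%N.

Let m_neq0 : m%:R != 0 :> R.
Proof. by rewrite pnatr_eq0; case: m m_gt2. Qed.

Lemma qpow_period (a : int) : qpow m (m%:Z * a)%:~R = 1 :> R[i].
Proof.
have qm : qpow m m%:R = 1 :> R[i].
  rewrite /qpow /theta; suff -> : (0 +i* (2 * pi / m%:R)) * m%:R =
    0 +i* (pi *+ 2) :> R[i].
    by rewrite /cexp expR0 cos2pi sin2pi !mul1r.
  have -> : m%:R = (m%:R : R)%:C :> R[i] by rewrite rmorph_nat.
  apply/eqP; rewrite eq_complex /=; apply/andP; split; apply/eqP; first by ring.
  by field.
have qmn n : qpow m (m%:R *+ n) = 1 :> R[i].
  by elim: n => [|n IH]; rewrite ?mulr0n ?qpow0 // mulrSr qpowD IH qm mulr1.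
case: a => n; rewrite ?NegzE ?mulrN ?mulrNz ?qpowN.
  by rewrite -PoszM -pmulrn natrM mulr_natr qmn.
by rewrite -PoszM -pmulrn natrM mulr_natr qmn invr1.
Qed.

(** Modulus and argument: the sine vanishes and the cosine is positive, hence equal to 1; then the
    real exponential factor is 1 too, so x is real. *)
Lemma qpow_eq1 x : qpow m x = 1 -> exists a : int, x = (m%:Z * a)%:~R.
Proof.
case: x => [a b]; rewrite /qpow /cexp /= !mul0r !add0r.
set t := theta R m => -[e1 e2].
have t0 : t != 0 by rewrite mulf_neq0 ?invr_eq0 // mulf_neq0 ?gt_eqF // pi_gt0.
have s0 : sin (t * a) = 0.
  by apply/eqP; move/eqP: e2; rewrite mulf_eq0 gt_eqF ?expR_gt0.
have c1 : cos (t * a) = 1.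
  have := sin0cos1 s0; rewrite ger0_norm //.
  by rewrite -(pmulr_rge0 _ (expR_gt0 (- (t * b)))) e1.
have b0 : b = 0.
  move: e1; rewrite c1 mulr1 -expR0 => /expR_inj/eqP.
  by rewrite oppr_eq0 mulf_eq0 (negPf t0) => /eqP.
have [c tc] := cos_eq1 c1; exists c; rewrite b0.
have -> : a = m%:R * c%:~R.
  have p0 : pi != 0 :> R by rewrite gt_eqF ?pi_gt0.
  apply: (mulfI t0); rewrite tc /t /theta -mulr_natr; field.
  by rewrite m_neq0.
rewrite -[_ +i* _]/((m%:R * c%:~R)%:C).
by rewrite intrM rmorphM /= rmorph_int rmorph_nat.
Qed.

(** Zeros of q-numbers come from q^(2x) = 1, which puts x in (m/2)Z; hence the half-integers in
    genericity and in convention (A). *)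
Lemma qpow_sqr_eq1 x : qpow m x ^+ 2 = 1 ->
  exists2 a : int, x = a%:~R / 2 & (m %| a)%Z.
Proof.
rewrite expr2 -qpowD => /qpow_eq1[a e]; exists (m%:Z * a); last exact: dvdz_mulr.
by rewrite -e; field.
Qed.

Hypothesis m_odd : odd m.

(** As m is odd it is coprime to 2, so that m | 2d gives m | d. *)
Lemma qpow_int_sqr (d : int) : (qpow m d%:~R ^+ 2 == 1 :> R[i]) = (m %| d)%Z.
Proof.
apply/eqP/idP => [/qpow_sqr_eq1[a e ma]|/dvdzP[a ->]].
  have {e}ad : a = 2 * d.
    have : a%:~R = (2 * d)%:~R :> R[i] by rewrite intrM e; field.
    by move/intr_inj.
  by move: ma; rewrite ad Gauss_dvdzr // coprimezE /= coprimen2.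
by rewrite mulrC qpow_period expr1n.
Qed.

Lemma qroot_neqV : qroot R m - (qroot R m)^-1 != 0.
Proof.
rewrite subr_eq0 qrootE; apply/eqP => e.
have /eqP : qpow m 1%:~R ^+ 2 = 1 :> R[i].
  by rewrite expr2 {1}e mulVf // qpow_neq0.
by rewrite qpow_int_sqr dvdz1 /= => /eqP m1; move: m_gt2; rewrite m1.
Qed.

Lemma qnum_eq0 x : (qnum m x == 0) = (qpow m x ^+ 2 == 1).
Proof.
rewrite /qnum mulf_eq0 invr_eq0 (negPf qroot_neqV) orbF subr_eq0 qpowN.
by rewrite -(inj_eq (mulfI (qpow_neq0 x))) mulfV ?qpow_neq0 // expr2.
Qed.

Lemma qnum_periodic x (d : int) : (m %| d)%Z -> qnum m (x + d%:~R) = qnum m x.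
Proof.
move=> /dvdzP[a ->]; rewrite [a * _]mulrC /qnum opprD -mulrNz -mulrN.
by rewrite !qpowD !qpow_period !mulr1.
Qed.

Lemma qpow_periodic x (d : int) : (m %| d)%Z -> qpow m (x + d%:~R) = qpow m x.
Proof. by move=> /dvdzP[a ->]; rewrite [a * _]mulrC qpowD qpow_period mulr1. Qed.

End QPow.

(** * Presented algebras, scalars, linear combinations *)

Section PresentedAlgebraInduction.
Variables (K : comNzRingType) (X : choiceType).
Local Notation free := {malg K[{fmonom X}]}.
Variable rel : free -> free -> Prop.
Local Notation pi := (@pres_pi K X rel).
Implicit Types a b : free.

(** The product is computed on chosen representatives, which differ from a and b by elements of a
    two-sided ideal. *)
Lemma pres_piM a b : pi (a * b) = pi a * pi b.
Proof.
have piP u w : pi u = pi w <-> rel_ideal rel (u - w).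
  split=> [/eqP|h]; last by apply/eqP; rewrite -Quotient.idealrBE; apply/mem_set.
  by rewrite -Quotient.idealrBE => /set_mem.
have piK u : rel_ideal rel (u - repr (pi u)) by apply/piP; rewrite [RHS]reprK.
have [I0 IB IM] := rel_idealP rel.
have ID u w : rel_ideal rel u -> rel_ideal rel w -> rel_ideal rel (u + w).
  by move=> Iu Iw; rewrite -[w]opprK -[- w]sub0r; exact: (IB _ _ Iu (IB _ _ I0 Iw)).
apply/piP; move: (repr (pi a)) (repr (pi b)) (piK a) (piK b) => a' b' Ia Ib.
have -> : a * b - a' * b' = a * (b - b') + (a - a') * b'.
  by rewrite mulrBr mulrBl addrA subrK.
by apply: ID; [have [] := IM a _ Ib | have [] := IM b' _ Ia].
Qed.

Lemma pres_piD a b : pi (a + b) = pi a + pi b.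
Proof. exact: Quotient.pi_add. Qed.

(** A free element is a sum of constants times words, and a word is a product of generators, by
    induction on its length. *)
Lemma pres_ind (P : pres_alg rel -> Prop) :
  (forall c, P (pres_const rel c)) -> (forall g, P (pres_gen rel g)) ->
  (forall x y, P x -> P y -> P (x + y)) ->
  (forall x y, P x -> P y -> P (x * y)) -> forall x, P x.
Proof.
move=> Pc Pg PD PM x.
have P1 : P (pi 1) by have := Pc 1; rewrite /pres_const mpolyC1E.
have P0 : P (pi 0) by have := Pc 0; rewrite /pres_const malgC0E.
have Pm (s : seq X) : P (pi << FMonom s >>).
  elim: s => [|g s IH]; first by rewrite -fmoneE; exact: P1.
  have -> : << FMonom (g :: s) >> = << fmu g >> * << FMonom s >> :> free.
    rewrite malgM_def fgmulUU mulr1; congr << _ >>.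
    by apply/val_inj; rewrite /= fmM fmU.
  by rewrite pres_piM; apply: PM; [exact: Pg | exact: IH].
have -> : x = pi (repr x) by rewrite [RHS]reprK.
move: (repr x : free) => y; rewrite [y]monalgE.
apply: (big_ind (fun a => P (pi a))) => // [u w Pu Pw|k _].
  by rewrite pres_piD; exact: PD.
have -> : << mcoeff k y *g k >> = (mcoeff k y)%:MP * << k >> :> free.
  by rewrite malgM_def fgmulUU mulr1 mul1m.
by rewrite pres_piM; apply: PM; [exact: Pc | case: (k)].
Qed.
End PresentedAlgebraInduction.

(** A presented algebra may be the zero ring, so its scalars enter as a central morphism into a mere
    ring. *)
Record central_scalars (K : nzRingType) (A : pzRingType) (cst : K -> A) : Prop :=
  CentralScalars {
    cst1 : cst 1 = 1;
    cstD : {morph cst : c d / c + d};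
    cstM : {morph cst : c d / c * d};
    cstC : forall c a, cst c * a = a * cst c }.

Lemma pres_const_central (K : comNzRingType) (X : choiceType)
    (rel : {malg K[{fmonom X}]} -> {malg K[{fmonom X}]} -> Prop) :
  central_scalars (pres_const rel).
Proof.
split=> [|c d|c d|c a].
- by rewrite /pres_const mpolyC1E.
- by rewrite /pres_const -pres_piD raddfD.
- by rewrite /pres_const -pres_piM mpolyCM.
- by rewrite pres_constE -[pres_scale c 1]/(c *: (1 : pres_alg rel)) -pres_scaleAr
    -pres_scaleAl mulr1 mul1r.
Qed.

Section Scalars.
Variables (K : comNzRingType) (A : pzRingType) (cst : K -> A).
Hypothesis cstP : central_scalars cst.
Variable V : lmodType A.
Implicit Types (c d : K) (x y : V) (a : A).

Definition scal c x := cst c *: x.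

Lemma scDl c d x : scal (c + d) x = scal c x + scal d x.
Proof. by rewrite /scal (cstD cstP) scalerDl. Qed.

Lemma sc0 x : scal 0 x = 0.
Proof. by apply: (addrI (scal 0 x)); rewrite -scDl !addr0. Qed.

Lemma scr0 c : scal c 0 = 0 :> V.
Proof. exact: scaler0. Qed.

Lemma sc1 x : scal 1 x = x.
Proof. by rewrite /scal (cst1 cstP) scale1r. Qed.

Lemma scA c d x : scal c (scal d x) = scal (c * d) x.
Proof. by rewrite /scal scalerA (cstM cstP). Qed.

Lemma scC a c x : a *: scal c x = scal c (a *: x).
Proof. by rewrite /scal !scalerA (cstC cstP). Qed.

Lemma scN1 x : scal (- 1) x = - x.
Proof. by apply/eqP; rewrite -addr_eq0 -[X in _ + X]sc1 -scDl addNr sc0. Qed.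

Lemma sc_sumr (I : Type) (r : seq I) (P : pred I) c (F : I -> V) :
  scal c (\sum_(i <- r | P i) F i) = \sum_(i <- r | P i) scal c (F i).
Proof. exact: scaler_sumr. Qed.

Lemma sc_suml (I : Type) (r : seq I) (P : pred I) (F : I -> K) x :
  scal (\sum_(i <- r | P i) F i) x = \sum_(i <- r | P i) scal (F i) x.
Proof. exact: (big_morph (fun c => scal c x) (fun c d => scDl c d x) (sc0 x)). Qed.
End Scalars.

Section Submodules.
Variables (A : pzRingType) (V : lmodType A).
Implicit Types (x y : V) (a : A).

Lemma submod0 (S : submod V) : submod_set S 0.
Proof. by have [] := submodP S. Qed.

Lemma submodD (S : submod V) x y : submod_set S x -> submod_set S y ->
  submod_set S (x + y).
Proof. by have [_ SD] := submodP S => Sx Sy; rewrite -[x]scale1r; exact: SD. Qed.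

Lemma submodZ (S : submod V) a x : submod_set S x -> submod_set S (a *: x).
Proof.
by have [S0 SD] := submodP S; rewrite -[a *: x]addr0 => Sx; exact: SD.
Qed.

Lemma submodB (S : submod V) x y : submod_set S x -> submod_set S y ->
  submod_set S (x - y).
Proof. by move=> Sx Sy; apply: submodD => //; rewrite -scaleN1r;
  exact: submodZ. Qed.

Lemma submod_sum (S : submod V) (I : Type) (r : seq I) (P : pred I) (F : I -> V) :
  (forall i, P i -> submod_set S (F i)) -> submod_set S (\sum_(i <- r | P i) F i).
Proof. by move=> SF; elim/big_ind: _ => //; [exact: submod0 | exact: submodD]. Qed.

Lemma submod_spanE (X0 : set V) (S : submod V) x :
  (forall y, X0 y -> submod_set S y) -> submod_set (submod_span X0) x ->
    submod_set S x.
Proof. by move=> XS; apply; split => //; exact: submodP. Qed.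

Lemma submod_span1P x y : submod_set (submod_span [set x]%classic) y ->
  exists a, y = a *: x.
Proof.
have sub : is_submod [set a *: x | a in [set: A]]%classic.
  split=> [|a _ _ [b _ <-] [c _ <-]]; first by exists 0; rewrite ?scale0r.
  by exists (a * b + c) => //; rewrite scalerDl scalerA.
case/(@submod_spanE _ (Submod sub)) => [_ ->|a _ <-]; last by exists a.
by exists 1; rewrite ?scale1r.
Qed.

Lemma submod_span1 x : submod_set (submod_span [set x]%classic) x.
Proof. by move=> S [_]; apply. Qed.
End Submodules.

Section LinearCombinations.
Variables (K : comNzRingType) (A : pzRingType) (cst : K -> A).
Hypothesis cstP : central_scalars cst.
Variables (V : lmodType A) (I : eqType) (P : set I) (T : I -> V).
Local Notation sc := (@scal K A cst V).
Implicit Types (L : seq (K * I)) (f : I -> K).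

(** Combinations are lists in which an index may occur several times: concatenation is then the sum,
    and equal indices are grouped only when freeness is used. *)
Definition lincomb L : V := \sum_(p <- L) sc p.1 (T p.2).

Definition evalcomb f L : K := \sum_(p <- L) p.1 * f p.2.

Definition supported (Q : I -> Prop) L := forall p, p \in L -> Q p.2.

Hypothesis spanT : forall x : V, exists (s : seq I) (c : I -> K),
  (forall i, i \in s -> P i) /\ x = \sum_(i <- s) sc (c i) (T i).
Hypothesis freeT : forall (s : seq I) (c : I -> K),
  uniq s -> (forall i, i \in s -> P i) ->
  \sum_(i <- s) sc (c i) (T i) = 0 -> forall i, i \in s -> c i = 0.

Lemma big_partition_snd (M : nmodType) (F : K * I -> M) L :
  \sum_(p <- L) F p =
  \sum_(i <- undup (map snd L)) \sum_(p <- L | p.2 == i) F p.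
Proof.
rewrite (exchange_big_dep predT) //= big_seq [RHS]big_seq.
apply: eq_bigr => p pL; rewrite (eq_bigl (fun i => i == p.2)); last first.
  by move=> i; rewrite eq_sym.
rewrite -big_filter (@filter_pred1_uniq _ _ p.2) ?big_seq1 ?undup_uniq //.
by rewrite mem_undup map_f.
Qed.

Lemma lincomb_eq0 f L : supported P L -> lincomb L = 0 -> evalcomb f L = 0.
Proof.
move=> PL; rewrite /lincomb /evalcomb (big_partition_snd (fun p =>
  sc p.1 (T p.2))) => L0.
set s := undup (map snd L) in L0.
pose c i := \sum_(p <- L | p.2 == i) p.1.
have c0 : forall i, i \in s -> c i = 0.
  apply: freeT; first exact: undup_uniq.
    by move=> i; rewrite mem_undup => /mapP[p pL ->]; exact: PL.
  rewrite -[RHS]L0; apply: eq_bigr => i _; rewrite /c (sc_suml cstP).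
  by apply: eq_bigr => p /eqP ->.
rewrite (big_partition_snd (fun p => p.1 * f p.2)) big_seq big1 // => i si.
transitivity (c i * f i); last by rewrite c0 // mul0r.
by rewrite mulr_suml; apply: eq_bigr => p /eqP ->.
Qed.

(** The coefficients of a relation among the basis vectors cancel index by index, so every family T'
    satisfies it. This stands in for the linear map sending T(i) to T'(i). *)
Lemma lincomb_transfer (T' : I -> V) L : supported P L -> lincomb L = 0 ->
  \sum_(p <- L) sc p.1 (T' p.2) = 0.
Proof.
move=> PL L0; rewrite (big_partition_snd (fun p => sc p.1 (T' p.2))) big1 // => i _.
transitivity (sc (evalcomb (fun l => (l == i)%:R) L) (T' i)); last first.
  by rewrite lincomb_eq0 // (sc0 cstP).
rewrite /evalcomb (sc_suml cstP) big_mkcond; apply: eq_bigr => p _.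
by case: eqP => [->|_]; rewrite ?mulr1 ?mulr0 ?(sc0 cstP).
Qed.

Lemma lincomb_cat L1 L2 : lincomb (L1 ++ L2) = lincomb L1 + lincomb L2.
Proof. exact: big_cat. Qed.

Lemma evalcomb_cat f L1 L2 : evalcomb f (L1 ++ L2) = evalcomb f L1 + evalcomb f L2.
Proof. exact: big_cat. Qed.

Definition scalecomb (c : K) L := [seq (c * p.1, p.2) | p <- L].

Lemma lincomb_scale c L : lincomb (scalecomb c L) = sc c (lincomb L).
Proof.
by rewrite /lincomb big_map sc_sumr; apply: eq_bigr => p _; rewrite (scA cstP).
Qed.

Lemma evalcomb_scale f c L : evalcomb f (scalecomb c L) = c * evalcomb f L.
Proof.
by rewrite /evalcomb big_map mulr_sumr; apply: eq_bigr => p _; rewrite mulrA.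
Qed.

Lemma supported_cat Q L1 L2 :
  supported Q L1 -> supported Q L2 -> supported Q (L1 ++ L2).
Proof. by move=> h1 h2 p; rewrite mem_cat => /orP[/h1|/h2]. Qed.

Lemma supported_scale Q c L : supported Q L -> supported Q (scalecomb c L).
Proof. by move=> h p /mapP[p' /h ? ->]. Qed.

Lemma lincomb_surj x : exists2 L, supported P L & lincomb L = x.
Proof.
have [s [c [sP ->]]] := spanT x.
exists [seq (c i, i) | i <- s]; last by rewrite /lincomb big_map.
by move=> _ /mapP[i si ->]; exact: sP.
Qed.

(** The linear functional with value f(i) at T(i). By [lincomb_eq0] the choice of the list
    representing x does not matter. *)
Definition coordsum f (x : V) : K := evalcomb f (s2val (cid2 (lincomb_surj x))).

Lemma coordsum_lincomb f L : supported P L -> coordsum f (lincomb L) = evalcomb f L.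
Proof.
move=> PL; rewrite /coordsum; case: cid2 => L' PL' /= e.
apply/eqP; rewrite -subr_eq0 -mulN1r -evalcomb_scale -evalcomb_cat; apply/eqP.
apply: lincomb_eq0; first by apply: supported_cat => //; exact: supported_scale.
by rewrite lincomb_cat lincomb_scale e (scN1 cstP) subrr.
Qed.

Lemma coordsumD f x y : coordsum f (x + y) = coordsum f x + coordsum f y.
Proof.
have [L PL <-] := lincomb_surj x; have [L' PL' <-] := lincomb_surj y.
by rewrite -lincomb_cat !coordsum_lincomb ?evalcomb_cat //; exact: supported_cat.
Qed.

Lemma coordsumN f x : coordsum f (- x) = - coordsum f x.
Proof.
have [L PL <-] := lincomb_surj x; rewrite -(scN1 cstP) -lincomb_scale.
rewrite !coordsum_lincomb ?evalcomb_scale ?mulN1r //; exact: supported_scale.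
Qed.

Lemma coordsum_basis f i : P i -> coordsum f (T i) = f i.
Proof.
move=> Pi; have -> : T i = lincomb [:: (1, i)].
  by rewrite /lincomb big_seq1 (sc1 cstP).
rewrite coordsum_lincomb; first by rewrite /evalcomb big_seq1 mul1r.
by move=> p; rewrite inE => /eqP ->.
Qed.
End LinearCombinations.

(** * The Gelfand-Tsetlin action *)

Section Coefficients.
Variables (R : realType) (n m : nat) (v : nat -> nat -> R[i]).
Hypotheses (m_gt2 : (2 < m)%N) (m_odd : odd m).
Local Notation tr := (translate v).
Implicit Types z d : array.

Definition row_cong k z z' := forall j, (1 <= j <= k)%N -> (m %| z' k j - z k j)%Z.

Lemma qnum_cong z z' a b c e : (m %| z' a b - z a b)%Z -> (m %| z' c e - z c e)%Z ->
  qnum m (tr z' a b - tr z' c e) = qnum m (tr z a b - tr z c e).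
Proof.
move=> h1 h2.
have -> : tr z' a b - tr z' c e =
    tr z a b - tr z c e + ((z' a b - z a b) - (z' c e - z c e))%:~R.
  by rewrite /translate; ring.
by rewrite qnum_periodic // rpredB.
Qed.

Lemma coefE_cong z z' k j : (1 <= j <= k)%N ->
  row_cong k z z' -> row_cong k.+1 z z' ->
  coefE m (tr z') k j = coefE m (tr z) k j.
Proof.
move=> jk h1 h2; rewrite /coefE; congr (- (_ / _)).
  by apply: eq_big_nat => i ik; apply: qnum_cong; [exact: h1 | exact: h2].
rewrite big_nat_cond [RHS]big_nat_cond; apply: eq_bigr => i /andP[ik _].
by apply: qnum_cong; apply: h1.
Qed.

Lemma coefF_cong z z' k j : (1 <= j <= k)%N ->
  row_cong k z z' -> row_cong k.-1 z z' ->
  coefF m (tr z') k j = coefF m (tr z) k j.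
Proof.
move=> jk h1 h2; rewrite /coefF; congr (_ / _).
  apply: eq_big_nat => i ik; apply: qnum_cong; first exact: h1.
  by apply: h2; lia.
rewrite big_nat_cond [RHS]big_nat_cond; apply: eq_bigr => i /andP[ik _].
by apply: qnum_cong; apply: h1.
Qed.

Lemma weight_cong z z' k : row_cong k z z' -> row_cong k.-1 z z' ->
  qpow m (weight (tr z') k) = qpow m (weight (tr z) k).
Proof.
move=> h1 h2.
pose s (y : array) := \sum_(1 <= i < k.+1) y k i - \sum_(1 <= i < k) y k.-1 i.
have ws y : weight (tr y) k = weight v k + (s y)%:~R.
  rewrite /weight /s /translate !big_split /= rmorphB !rmorph_sum /=; ring.
have -> : weight (tr z') k = weight (tr z) k + (s z' - s z)%:~R.
  by rewrite !ws [(s z' - _)%:~R]rmorphB /=; ring.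
rewrite qpow_periodic //.
have -> : s z' - s z = \sum_(1 <= i < k.+1) (z' k i - z k i) -
    \sum_(1 <= i < k) (z' k.-1 i - z k.-1 i) by rewrite /s !sumrB; ring.
apply: rpredB; rewrite big_nat; apply: rpred_sum => i ik; first exact: h1.
by apply: h2; lia.
Qed.

Definition mult_array (d : array) := forall i j, (m %| d i j)%Z.

Lemma row_cong_shift k z d : mult_array d -> row_cong k z (z + d).
Proof. by move=> md j _; rewrite -[(z + d) k j]/(z k j + d k j) addrC addKr. Qed.

Lemma int_shiftD z d : int_shift n z -> int_shift n d -> int_shift n (z + d).
Proof. by move=> hz hd i j h; rewrite -[LHS]/(z i j + d i j) hz // hd. Qed.

Lemma int_shiftN z : int_shift n z -> int_shift n (- z).
Proof. by move=> hz i j h; rewrite -[LHS]/(- z i j) hz. Qed.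

Lemma int_shift0 : int_shift n 0. Proof. by []. Qed.

Lemma int_shift_delta k j : position n.-1 k j -> int_shift n (delta k j).
Proof.
move=> pkj a b nab; rewrite /delta; case: eqP => [ak|//].
by case: eqP => // bj; case: nab; rewrite ak bj.
Qed.
End Coefficients.

Section ActionRecord.
Variables (R : realType) (n m : nat) (v : nat -> nat -> R[i]).
Variables (A : pzRingType) (cst : R[i] -> A) (V : lmodType A) (T : array -> V).
Local Notation tr := (translate v).
Local Notation Lam := (int_shift n).
Local Notation sc := (@scal _ A cst V).

Definition acts_as_E k a := forall z, Lam z ->
  a *: T z = \sum_(1 <= j < k.+1) sc (coefE m (tr z) k j) (T (z + delta k j)).

Definition acts_as_F k a := forall z, Lam z ->
  a *: T z = \sum_(1 <= j < k.+1) sc (coefF m (tr z) k j) (T (z - delta k j)).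

Definition acts_as_K k a := forall z, Lam z ->
  a *: T z = sc (qpow m (weight (tr z) k)) (T z).

Definition acts_as_Kinv k a := forall z, Lam z ->
  a *: T z = sc (qpow m (weight (tr z) k))^-1 (T z).

(* All that is used of U_q: operators on the T z that, with the scalars, generate it. *)
Record GT_action : Prop := GTAction {
  actC : central_scalars cst;
  act_span : forall x : V, exists (s : seq array) (c : array -> R[i]),
    (forall i, i \in s -> Lam i) /\ x = \sum_(i <- s) sc (c i) (T i);
  act_free : forall (s : seq array) (c : array -> R[i]),
    uniq s -> (forall i, i \in s -> Lam i) ->
    \sum_(i <- s) sc (c i) (T i) = 0 -> forall i, i \in s -> c i = 0;
  act_E : forall k, (1 <= k <= n.-1)%N -> exists a, acts_as_E k a;
  act_F : forall k, (1 <= k <= n.-1)%N -> exists a, acts_as_F k a;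
  act_K : forall k, (1 <= k <= n)%N -> exists a, acts_as_K k a;
  act_ind : forall P : A -> Prop, (forall c, P (cst c)) ->
    (forall k a, (1 <= k <= n.-1)%N -> acts_as_E k a -> P a) ->
    (forall k a, (1 <= k <= n.-1)%N -> acts_as_F k a -> P a) ->
    (forall k a, (1 <= k <= n)%N -> acts_as_K k a -> P a) ->
    (forall k a, (1 <= k <= n)%N -> acts_as_Kinv k a -> P a) ->
    (forall a b, P a -> P b -> P (a + b)) ->
    (forall a b, P a -> P b -> P (a * b)) -> forall a, P a }.
End ActionRecord.

Section Action.
Variables (R : realType) (n m : nat) (v : nat -> nat -> R[i]).
Variables (A : pzRingType) (cst : R[i] -> A) (V : lmodType A) (T : array -> V).
Hypotheses (m_gt2 : (2 < m)%N) (m_odd : odd m).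
Hypothesis GT : GT_action n m v cst T.
Local Notation tr := (translate v).
Local Notation Lam := (int_shift n).
Local Notation sc := (@scal _ A cst V).
Local Notation comb := (lincomb cst T).
Implicit Types (z d : array) (a : A).

(** Closure under the arrows with nonzero coefficient, which makes the T(z) with Q(z) span a
    submodule ([span_stable]). *)
Definition stable (Q : array -> Prop) := forall z k j,
  Lam z -> Q z -> position n.-1 k j ->
  (coefE m (tr z) k j != 0 -> Q (z + delta k j)) /\
  (coefF m (tr z) k j != 0 -> Q (z - delta k j)).

Definition shiftcomb d (L : seq (R[i] * array)) := [seq (p.1, p.2 + d) | p <- L].

Lemma lincomb_shift_scale d c L :
  comb (shiftcomb d (scalecomb c L)) = sc c (comb (shiftcomb d L)).
Proof.
rewrite -(lincomb_scale (actC GT)) /shiftcomb /scalecomb -!map_comp.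
by [].
Qed.

(** One list L serves all translates: this expresses that a commutes with translations divisible by
    m. The last clause confines the support to every stable set containing z. *)
Definition action_on a z := exists L,
  [/\ supported Lam L,
      forall d, Lam d -> mult_array m d ->
        a *: T (z + d) = comb (shiftcomb d L)
    & forall Q, stable Q -> Q z -> supported Q L].

Lemma action_diag a (c : array -> R[i]) :
  (forall z d, mult_array m d -> c (z + d) = c z) ->
  (forall z, Lam z -> a *: T z = sc (c z) (T z)) ->
  forall z, Lam z -> action_on a z.
Proof.
move=> cd aT z hz; exists [:: (c z, z)]; split=> [p|d hd md|Q _ Qz p].
- by rewrite inE => /eqP ->.
- by rewrite /lincomb big_seq1 /= aT ?cd //; exact: int_shiftD.
- by rewrite inE => /eqP ->.
Qed.

Lemma action_step a k (c : array -> nat -> R[i]) (e : nat -> array) :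
  (1 <= k <= n.-1)%N ->
  (forall z d j, (1 <= j <= k)%N -> mult_array m d -> c (z + d) j = c z j) ->
  (forall z j, position n.-1 k j -> Lam z -> Lam (z + e j) /\
    forall Q, stable Q -> Q z -> c z j != 0 -> Q (z + e j)) ->
  (forall z, Lam z -> a *: T z = \sum_(1 <= j < k.+1) sc (c z j) (T (z + e j))) ->
  forall z, Lam z -> action_on a z.
Proof.
move=> /andP[k1 kn] cd cQ aT z hz.
(* Terms with coefficient 0 are dropped, since stability says nothing about their targets. *)
exists [seq (c z j, z + e j) | j <- index_iota 1 k.+1 & c z j != 0].
have pj j : j \in [seq j <- index_iota 1 k.+1 | c z j != 0] ->
    position n.-1 k j /\ c z j != 0.
  by rewrite mem_filter mem_index_iota => /andP[-> jk].
split=> [p /mapP[j /pj[pos cj] ->]|d hd md|Q sQ Qz p /mapP[j /pj[pos cj] ->]] /=.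
- by have [] := cQ z j pos hz.
- rewrite /lincomb !big_map big_filter [RHS]big_mkcond aT; last exact: int_shiftD.
  apply: eq_big_nat => j jk /=; rewrite cd // addrAC.
  by case: eqP => //= ->; rewrite (sc0 (actC GT)).
- by have [_] := cQ z j pos hz; apply.
Qed.

Lemma action_lincomb a : (forall z, Lam z -> action_on a z) ->
  forall L, supported Lam L -> exists L',
    [/\ supported Lam L',
      forall d, Lam d -> mult_array m d ->
        a *: comb (shiftcomb d L) = comb (shiftcomb d L')
    & forall Q, stable Q -> supported Q L -> supported Q L'].
Proof.
move=> Pa; elim=> [|[c y] L IH] sL.
  by exists [::]; split=> // d _ _; rewrite /lincomb big_nil scaler0.
have [|L1 [s1 e1 q1]] := IH; first by move=> p pL; apply: sL; rewrite inE pL orbT.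
have [|L2 [s2 e2 q2]] := Pa y; first by apply: (sL (c, y)); exact: mem_head.
exists (scalecomb c L2 ++ L1); split=> [|d hd md|Q sQ QL].
- by apply: supported_cat => //; exact: supported_scale.
- rewrite {2}/shiftcomb map_cat lincomb_cat -/(shiftcomb _ _) -/(shiftcomb _ _).
  rewrite -e1 // lincomb_shift_scale -e2 // -(scC (actC GT)).
  by rewrite /lincomb big_cons /= scalerDr.
- apply: supported_cat; first by apply: supported_scale; apply: q2 => //;
  exact: (QL (c, y) (mem_head _ _)).
  by apply: q1 => // p pL; apply: QL; rewrite inE pL orbT.
Qed.

Lemma action a z : Lam z -> action_on a z.
Proof.
move: z; elim/(act_ind GT): a => [c|k a hk aE|k a hk aF|k a hk aK|k a hk aK|a b
  Pa Pb|a b Pa Pb].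
- by apply: (action_diag (c := fun _ => c)).
- apply: (action_step (c := fun z => coefE m (tr z) k) (e := delta k) hk _ _ aE).
    by move=> z d j jk md; apply: coefE_cong => //; exact: row_cong_shift.
  move=> z j pos hz; split; first by apply: int_shiftD => //;
    exact: int_shift_delta.
  by move=> Q sQ Qz; have [] := sQ z k j hz Qz pos.
- apply: (action_step (c := fun z => coefF m (tr z) k) (e := fun j =>
  - delta k j) hk _ _ aF).
    by move=> z d j jk md; apply: coefF_cong => //; exact: row_cong_shift.
  move=> z j pos hz; split.
    by apply: int_shiftD => //; apply: int_shiftN; exact: int_shift_delta.
  by move=> Q sQ Qz; have [] := sQ z k j hz Qz pos.
- apply: (action_diag _ aK) => z d md; apply: weight_cong => //;
  exact: row_cong_shift.
- apply: (action_diag _ aK) => z d md; congr _^-1.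
  apply: weight_cong => //; exact: row_cong_shift.
- move=> z hz; have [L1 [s1 e1 q1]] := Pa z hz; have [L2 [s2 e2 q2]] := Pb z hz.
  exists (L1 ++ L2); split=> [|d hd md|Q sQ Qz]; first exact: supported_cat.
    by rewrite /shiftcomb map_cat lincomb_cat scalerDl e1 // e2.
  by apply: supported_cat; [exact: q1 | exact: q2].
- move=> z hz; have [L1 [s1 e1 q1]] := Pb z hz.
  have [L2 [s2 e2 q2]] := action_lincomb Pa s1.
  exists L2; split=> // [d hd md|Q sQ Qz]; first by rewrite -scalerA e1 // e2.
  by apply: q2 => //; exact: q1.
Qed.

Lemma shiftcomb0 L : shiftcomb 0 L = L.
Proof. by rewrite /shiftcomb -[RHS]map_id; apply: eq_map => -[c z];
  rewrite /= addr0. Qed.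

Lemma span_stable_subproof (Q : array -> Prop) : stable Q ->
  is_submod [set x | exists2 L, supported (fun z =>
    Lam z /\ Q z) L & x = comb L]%classic.
Proof.
move=> sQ; split=> [|a _ _ [L sL ->] [L' sL' ->]].
  by exists [::]; rewrite ?/lincomb ?big_nil.
have sLL : supported Lam L by move=> p /sL[].
have [L1 [s1 e1 q1]] := action_lincomb (@action a) sLL.
exists (L1 ++ L'); last first.
  by rewrite lincomb_cat -[L in a *: comb L]shiftcomb0 e1 ?shiftcomb0 // =>
    i j; exact: dvdz0.
apply: supported_cat => // p pL1; split; first exact: s1.
by apply: (q1 Q sQ) => // p' /sL[].
Qed.

Definition span_stable Q (sQ : stable Q) : submod V := Submod
  (span_stable_subproof sQ).
End Action.

(** * Vanishing of the Gelfand-Tsetlin coefficients *)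

Lemma is_half_int_int (R : realType) (x : R[i]) (d : int) :
  is_half_int (x + d%:~R) -> is_half_int x.
Proof.
case=> a e; exists (a - d * 2).
by rewrite -[x](addrK d%:~R) e intrB intrM; field.
Qed.

Lemma size_monic_sub (K : nzRingType) (p p' : {poly K}) k :
  p \is monic -> p' \is monic -> size p = k.+1 -> size p' = k.+1 ->
  (size (p - p')%R <= k)%N.
Proof.
move=> /monicP mp /monicP mp' sp sp'; apply/leq_sizeP => i.
rewrite leq_eqVlt coefB => /orP[/eqP <-|ki].
  by move: mp mp'; rewrite /lead_coef sp sp' => -> ->; rewrite subrr.
by rewrite !nth_default ?sp ?sp' // subrr.
Qed.

Section Separation.
Variables (R : realType) (n m : nat) (v : nat -> nat -> R[i]).
Hypotheses (m_gt2 : (2 < m)%N) (m_odd : odd m).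
Hypotheses (v_gen : generic n v) (vA : conventionA n v) (vB : conventionB n v).
Local Notation tr := (translate v).
Local Notation Lam := (int_shift n).
Implicit Types z c d : array.

Lemma qnum_tr_eq0 z a b e f (d : int) : v a b - v e f = d%:~R ->
  (qnum m (tr z a b - tr z e f) == 0) = (m %| d + z a b - z e f)%Z.
Proof.
move=> vd; rewrite qnum_eq0 //.
have -> : tr z a b - tr z e f = (d + z a b - z e f)%:~R.
  by rewrite !rmorphB rmorphD /= -vd /translate; ring.
exact: qpow_int_sqr.
Qed.

Lemma qpow_tr_half z a b e f (d : int) : qpow m (tr z a b - tr z e f + d%:~R)
  ^+ 2 = 1 ->
  is_half_int (v a b - v e f).
Proof.
move/(qpow_sqr_eq1 m_gt2) => [r h _]; apply: (@is_half_int_int _ _ (z a b - z e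
  f + d)).
exists r; rewrite -h /translate rmorphD rmorphB /=; ring.
Qed.

(** A zero forces the difference of the entries of v to be a half-integer, and convention (A) then
    makes it an integer. *)
Lemma qnum_tr_int z a b e f : position n a b -> position n e f ->
  qnum m (tr z a b - tr z e f) = 0 -> exists d : int, v a b - v e f = d%:~R.
Proof.
move=> p1 p2 /eqP; rewrite qnum_eq0 // -[tr z a b - _]addr0 =>
  /eqP/(@qpow_tr_half _ _ _ _ _ 0).
by case: (vA p1 p2).
Qed.

Lemma qnum_row_neq0 z k i j : position n.-1 k i -> position n.-1 k j -> i != j ->
  qnum m (tr z k i - tr z k j) != 0.
Proof.
move=> pi pj ij; apply/eqP => /eqP; rewrite qnum_eq0 // -[tr z k i - _]addr0 =>
  /eqP.
by move=> /(@qpow_tr_half _ _ _ _ _ 0); exact: v_gen.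
Qed.

Definition linked k j := v k.+1 j == v k j.

Lemma link_inner k i j (d : int) : (k.+1 <= n.-1)%N -> (1 <= i <= k)%N ->
  (1 <= j <= k.+1)%N -> v k.+1 j - v k i = d%:~R -> j = i /\ linked k i.
Proof.
move=> kn ik jk vd; have [B1 _] := vB.
have jl : int_links v k.+1 i j by split=> //; exists d.
have ne : (int_links v k.+1 i !=set0)%classic by exists j.
have [||e lk] := B1 k.+1 i _ _ ne; try lia.
by move: jl; rewrite e => ->; split=> //; exact/eqP.
Qed.

Lemma link_top i j (d : int) : (1 <= i <= n)%N -> (1 <= j <= n.-1)%N ->
  v n i - v n.-1 j = d%:~R -> linked n.-1 j.
Proof.
move=> ik jk vd; have [_ B2] := vB; rewrite /linked prednK; last lia.
by apply/eqP/B2 => //; exists i; split=> //; exists d.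
Qed.

Definition denominator (w : nat -> nat -> R[i]) k j :=
  \prod_(1 <= i < k.+1 | i != j) qnum m (w k j - w k i).

Lemma denominator_neq0 z k j : position n.-1 k j -> denominator (tr z) k j != 0.
Proof.
move=> pos; rewrite /denominator prodf_seq_neq0; apply/allP => i.
rewrite mem_index_iota => ik; apply/implyP => ij.
have [_ kn] := pos.
by apply: qnum_row_neq0; rewrite 1?eq_sym.
Qed.

Lemma prod_nat_eq0 (a b : nat) (f : nat -> R[i]) : \prod_(a <= i < b) f i = 0 ->
  exists2 i, (a <= i < b)%N & f i = 0.
Proof.
move/eqP; rewrite prodf_seq_eq0 => /hasP[l]; rewrite mem_index_iota => lab /= /eqP.
by exists l.
Qed.

Lemma prod_nat_0 (a b i : nat) (f : nat -> R[i]) : (a <= i < b)%N -> f i = 0 ->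
  \prod_(a <= i < b) f i = 0.
Proof.
move=> iab fi; apply/eqP; rewrite prodf_seq_eq0; apply/hasP; exists i.
  by rewrite mem_index_iota.
by rewrite /= fi.
Qed.

(** The denominator is nonzero by genericity, so a factor of the numerator vanishes, and by
    convention (B) only the entry of column j in row k-1 can produce it. *)
Lemma coefF_eq0 z k j : position n.-1 k j -> coefF m (tr z) k j = 0 ->
  [/\ (j < k)%N, linked k.-1 j & (m %| z k j - z k.-1 j)%Z].
Proof.
case: k => [|k] pos; first by case: pos; lia.
move/eqP; rewrite /coefF mulf_eq0 invr_eq0 (negPf (denominator_neq0 z pos)) orbF.
have [jk kn] := pos => /eqP/prod_nat_eq0[i ik e0].
have [||d vd] := qnum_tr_int _ _ e0; try by split; lia.
have [|||ji lk] := link_inner _ _ _ vd; try lia.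
rewrite /= -{}ji in lk ik e0 vd *; split=> //; first by case/andP: ik.
move/eqP: e0; rewrite (@qnum_tr_eq0 _ _ _ _ _ 0) ?add0r //.
by rewrite (eqP lk) subrr.
Qed.

Lemma coefF_linked z k j : (1 <= j < k)%N -> linked k.-1 j ->
  (m %| z k j - z k.-1 j)%Z -> coefF m (tr z) k j = 0.
Proof.
move=> jk /eqP; rewrite prednK; last lia.
move=> lk h; rewrite /coefF (prod_nat_0 jk) ?mul0r //; apply/eqP.
by rewrite (@qnum_tr_eq0 _ _ _ _ _ 0) ?add0r // lk subrr.
Qed.

(** What can block raising z at (k, j): the linked entry of the next row or, in row n-1, any v_ni in
    the integer class of v_(n-1,j), since (B) allows several of them. *)
Definition barrier z k j := (m %| z k j - z k.+1 j)%Z \/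
  k = n.-1 /\ exists i (d : int),
    [/\ (1 <= i <= n)%N, v n i - v n.-1 j = d%:~R & (m %| z k j - d)%Z].

Lemma coefE_eq0 z k j : Lam z -> position n.-1 k j -> coefE m (tr z) k j = 0 ->
  linked k j /\ barrier z k j.
Proof.
move=> hz pos /eqP; rewrite oppr_eq0 mulf_eq0 invr_eq0.
rewrite (negPf (denominator_neq0 z pos)) orbF.
have [jk kn] := pos => /eqP/prod_nat_eq0[i ik e0].
have [||d vd] := qnum_tr_int _ _ e0; try by split; lia.
have vd' : v k.+1 i - v k j = (- d)%:~R by rewrite rmorphN /= -vd opprB.
have [kn1|] := ltnP k n.-1.
  have [|||ij lk] := link_inner _ _ _ vd'; try lia.
  split=> //; left; move/eqP: e0; rewrite ij (@qnum_tr_eq0 _ _ _ _ _ 0) ?add0r //.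
  by rewrite (eqP lk) subrr.
move=> nk; have {nk kn} kn : k = n.-1 by lia.
have nk : k.+1 = n by lia.
rewrite nk kn in vd'; rewrite kn; split; first by apply: (link_top _ _ vd'); lia.
right; split=> //; exists i, (- d); split=> //; first lia.
move/eqP: e0; rewrite (@qnum_tr_eq0 _ _ _ _ _ d) // nk kn opprK addrC.
by rewrite [z n i]hz ?oppr0 ?add0r 1?addrC // => -[]; lia.
Qed.

Lemma coefE_linked z k j : (1 <= j <= k)%N -> linked k j ->
  (m %| z k j - z k.+1 j)%Z -> coefE m (tr z) k j = 0.
Proof.
move=> jk /eqP lk h; rewrite /coefE (@prod_nat_0 _ _ j);
  first by rewrite mul0r oppr0.
  by lia.
by apply/eqP; rewrite (@qnum_tr_eq0 _ _ _ _ _ 0) ?add0r // lk subrr.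
Qed.

Lemma coefE_top z i j (d : int) : (1 < n)%N -> Lam z -> (1 <= i <= n)%N ->
  (1 <= j <= n.-1)%N ->
  v n i - v n.-1 j = d%:~R -> (m %| z n.-1 j - d)%Z -> coefE m (tr z) n.-1 j = 0.
Proof.
move=> n1 hz ik jk vd h; rewrite /coefE (@prod_nat_0 _ _ i);
  first by rewrite mul0r oppr0.
  by rewrite prednK //; lia.
have nk : n.-1.+1 = n by lia.
apply/eqP; rewrite (@qnum_tr_eq0 _ _ _ _ _ (- d));
  last by rewrite nk rmorphN /= -vd opprB.
by rewrite nk [z n i]hz ?subr0 1?addrC // => -[]; lia.
Qed.
End Separation.

(** * Row k+1 modulo m from the eigenvalues of loops *)

Section RowDetermined.
Variables (R : realType) (n m : nat) (v : nat -> nat -> R[i]).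
Hypotheses (m_gt2 : (2 < m)%N) (m_odd : odd m).
Hypotheses (v_gen : generic n v) (vA : conventionA n v) (vB : conventionB n v).
Local Notation tr := (translate v).
Local Notation Lam := (int_shift n).
Implicit Types z c d : array.

(** Factor by factor, [u - w]_q q^w = (q^(2u) - q^(2w)) / (q^u (q - q^-1)). This turns the numerator
    of [coefE] into a value of a monic polynomial at q^(2u). *)
Lemma prod_qnum (s : seq nat) (w : nat -> R[i]) u :
  \prod_(i <- s) qnum m (u - w i) * \prod_(i <- s) qpow m (w i) =
  (\prod_(i <- s) (qpow m u * (qroot R m - (qroot R m)^-1))^-1) *
    (\prod_(i <- s) ('X - (qpow m (w i) ^+ 2)%:P)).[qpow m u ^+ 2].
Proof.
rewrite horner_prod -!big_split /=; apply: eq_bigr => i _.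
rewrite hornerXsubC /qnum opprB !qpowD !qpowN.
have := qpow_neq0 m u; have := qpow_neq0 m (w i);
  have := @qroot_neqV R _ m_gt2 m_odd.
move: (qpow m u) (qpow m (w i)) (qroot R m - _) => a b q q0 b0 a0.
by field; rewrite q0 b0 a0.
Qed.

Definition cong_upto k z z' := forall a, (a <= k)%N -> row_cong m a z z'.

Lemma cong_uptoC k z z' : cong_upto k z z' -> cong_upto k z' z.
Proof. by move=> h a ak j ja; rewrite -opprB rpredN; exact: h. Qed.

Lemma cong_upto_trans k z1 z2 z3 :
  cong_upto k z1 z2 -> cong_upto k z2 z3 -> cong_upto k z1 z3.
Proof.
move=> h1 h2 a ak j ja.
by rewrite -[z3 a j](subrK (z2 a j)) -addrA rpredD //; [exact: h2 | exact: h1].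
Qed.

Lemma cong_uptoD k z z' d : cong_upto k z z' -> cong_upto k (z + d) (z' + d).
Proof.
move=> h a ak j ja; rewrite -[(z' + d) a j]/(z' a j + d a j).
by rewrite -[(z + d) a j]/(z a j + d a j) opprD addrACA subrr addr0; exact: h.
Qed.

Lemma coefE_prod z k j : position n.-1 k j ->
  \prod_(1 <= i < k.+2) qnum m (tr z k j - tr z k.+1 i) =
  - (coefE m (tr z) k j * denominator m (tr z) k j).
Proof.
move=> pos; have := denominator_neq0 m_gt2 m_odd v_gen z pos.
by rewrite /coefE /denominator => ?; rewrite mulNr opprK divfK.
Qed.

Lemma denominator_cong z z' k j : (1 <= j <= k)%N -> row_cong m k z z' ->
  denominator m (tr z') k j = denominator m (tr z) k j.
Proof.
move=> jk h; rewrite /denominator big_nat_cond [RHS]big_nat_cond.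
by apply: eq_bigr => i /andP[ik _]; apply: qnum_cong => //; exact: h.
Qed.

(** The difference of the two monic polynomials of degree k+1 has degree at most k and vanishes at
    k+1 distinct points: the x_j, and 0, where the values are the products of the roots up to a
    common sign. *)
Lemma monic_prod_determined (s : seq nat) (a b x : nat -> R[i]) k :
  size s = k.+1 -> \prod_(i <- s) a i = \prod_(i <- s) b i ->
  let P f := \prod_(i <- s) ('X - (f i)%:P) in
  (forall j, (1 <= j <= k)%N -> x j != 0 /\ (P a).[x j] = (P b).[x j]) ->
  (forall i j, (1 <= i <= k)%N -> (1 <= j <= k)%N -> x i = x j -> i = j) ->
  P a = P b.
Proof.
move=> sk ab P hx xinj; apply/eqP; rewrite -subr_eq0; apply/eqP.
apply: (@roots_geq_poly_eq0 _ _ (0 :: [seq x j | j <- iota 1 k])).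
- rewrite /= rootE hornerD hornerN !horner_prod.
  have e f : \prod_(i <- s) ('X - (f i)%:P).[0] =
    (- 1) ^+ k.+1 * \prod_(i <- s) f i :> R[i].
    rewrite -sk -[size s]count_predT -iter_mulr_1 -big_const_seq -big_split /=.
    by apply: eq_bigr => i _; rewrite hornerXsubC sub0r mulN1r.
  rewrite !e ab subrr eqxx /=; apply/allP => _ /mapP[j + ->].
  rewrite mem_iota => jk; rewrite rootE hornerD hornerN.
  by have [|_ ->] := hx j; [lia | rewrite subrr].
- rewrite /= map_inj_in_uniq ?iota_uniq ?andbT; last first.
    by move=> i j; rewrite !mem_iota => ik jk; apply: xinj; lia.
  apply/mapP => -[j]; rewrite mem_iota => jk x0.
  by have [|/eqP + _] := hx j; [lia | rewrite -x0].
rewrite /= size_map size_iota; apply: size_monic_sub; try exact: monic_prod_XsubC.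
  by rewrite size_prod_XsubC sk.
by rewrite size_prod_XsubC sk.
Qed.

(** The products in the hypotheses are the eigenvalues of the loops F E and E F at (k, j); the power
    of q is that of K_(k+1). *)
Lemma row_determined k c c' : (k < n.-1)%N -> cong_upto k c c' ->
  qpow m (weight (tr c) k.+1) = qpow m (weight (tr c') k.+1) ->
  (forall j, (1 <= j <= k)%N ->
    coefE m (tr c) k j * coefF m (tr (c + delta k j)) k j =
    coefE m (tr c') k j * coefF m (tr (c' + delta k j)) k j) ->
  (forall j, (1 <= j <= k)%N ->
    coefF m (tr c) k j * coefE m (tr (c - delta k j)) k j =
    coefF m (tr c') k j * coefE m (tr (c' - delta k j)) k j) ->
  row_cong m k.+1 c c'.
Proof.
move=> kn cc' wcc' hEF hFE.
have ck : row_cong m k c c' by exact: cc'.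
have ckp : row_cong m k.-1 c c' by apply: cc'; exact: leq_pred.
pose w z i := tr z k.+1 i; pose s := index_iota 1 k.+2.
pose P z : {poly R[i]} := \prod_(i <- s) ('X - (qpow m (w z i) ^+ 2)%:P).
(* The constant terms agree: rows k of c and c' are congruent, so equality of the weights compares
   the sums of rows k+1. *)
have prodw : \prod_(i <- s) qpow m (w c i) = \prod_(i <- s) qpow m (w c' i).
  have sumk : qpow m (\sum_(1 <= i < k.+1) tr c' k i) =
    qpow m (\sum_(1 <= i < k.+1) tr c k i).
    have -> : \sum_(1 <= i < k.+1) tr c' k i =
        \sum_(1 <= i < k.+1) tr c k i + (\sum_(1 <= i < k.+1) (c' k i - c k i))%:~R.
      rewrite rmorph_sum -big_split /=; apply: eq_bigr => i _.
      by rewrite /translate rmorphB /=; ring.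
    by rewrite qpow_periodic // big_nat; apply: rpred_sum => i ik; exact: ck.
  rewrite -!qpow_sum; move: wcc'; rewrite /weight !qpowD !qpowN /= sumk.
  by move=> /mulIf h; apply: (mulIf _ (h (qpow_neq0 _ _)));
    rewrite invr_eq0 qpow_neq0.
(* Equal raising coefficients at c + d and c' + d amount to a common value of the two
   polynomials. *)
have red j d : (1 <= j <= k)%N -> (forall i, d k.+1 i = 0) ->
    coefE m (tr (c + d)) k j = coefE m (tr (c' + d)) k j ->
    (P c).[qpow m (tr c k j + (d k j)%:~R) ^+ 2] =
    (P c').[qpow m (tr c k j + (d k j)%:~R) ^+ 2].
  move=> jk d0 hE; set u := tr c k j + _.
  have pos : position n.-1 k j by split=> //; lia.
  have trd z i : tr (z + d) k.+1 i = w z i.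
    by rewrite /w /translate -[(z + d) _ _]/(z k.+1 i + d k.+1 i) d0 addr0.
  have cdk : row_cong m k (c + d) (c' + d) by exact: (cong_uptoD _ cc').
  have e1 : \prod_(i <- s) qnum m (u - w c i) = \prod_(i <- s) qnum m (u - w c' i).
    have := coefE_prod (c + d) pos; have := coefE_prod (c' + d) pos.
    rewrite hE (denominator_cong jk cdk) => <- e.
    transitivity (\prod_(i <- s) qnum m (tr (c + d) k j - tr (c + d) k.+1 i)).
      apply: eq_bigr => i _; rewrite trd /u /translate -[(c + d) k j]/(c k j +
        d k j).
      by rewrite rmorphD /= addrA.
    rewrite e; apply: eq_bigr => i _; rewrite trd.
    have -> : tr (c' + d) k j - w c' i = u - w c' i + (c' k j - c k j)%:~R.
      rewrite /u /translate -[(c' + d) k j]/(c' k j + d k j) rmorphD rmorphB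
        /=; ring.
    by rewrite qnum_periodic //; exact: ck.
  have := prod_qnum s (w c) u; rewrite e1 prodw prod_qnum => /mulfI -> //.
  rewrite prodf_seq_neq0; apply/allP => i _ /=.
  by rewrite invr_eq0 mulf_neq0 ?qpow_neq0 // qroot_neqV.
(* The loop F E yields e = 0 and the loop E F yields e = -1, depending on which lowering coefficient
   is nonzero. Outside 1 <= j <= k the value is a filler for [choice]. *)
have point j : exists e : int, (1 <= j <= k)%N ->
    (P c).[qpow m (tr c k j + e%:~R) ^+ 2] = (P c').[qpow m (tr c k j + e%:~R)
      ^+ 2].
  have [jk|njk] := boolP (1 <= j <= k)%N; last by exists 0.
  have pos : position n.-1 k j by split=> //; lia.
  have d1 i : delta k j k.+1 i = 0 by rewrite /delta (gtn_eqF (ltnSn k)).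
  have [F0|F0] := eqVneq (coefF m (tr (c + delta k j)) k j) 0; last first.
    exists 0 => _; apply: (red j 0) => //; rewrite !addr0.
    have := hEF j jk; rewrite (@coefF_cong _ m v m_gt2 m_odd (c + delta k j)
      (c' + delta k j)) //.
    - by move/mulIf; apply.
    - exact: (cong_uptoD _ cc').
    - by apply: (cong_uptoD _ cc'); exact: leq_pred.
  have [jk1 lk mdiv] := coefF_eq0 m_gt2 m_odd v_gen vA vB pos F0.
  (* If the lowering coefficients at c and at c + delta^kj both vanished, m would divide two
     consecutive integers. *)
  have F1 : coefF m (tr c) k j != 0.
    apply/eqP => /(coefF_eq0 m_gt2 m_odd v_gen vA vB pos)[_ _ mdiv'].
    have : (m %| 1)%Z.
      have -> : 1%Z = ((c + delta k j) k j - (c + delta k j) k.-1 j) - (c k j -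
        c k.-1 j) :> int.
        rewrite -![(c + _) _ _]/(c _ j + delta k j _ j) /delta !eqxx /=.
        by rewrite (_ : (k.-1 == k) = false) /=; [ring | apply/negbTE; lia].
      exact: rpredB.
    by rewrite dvdz1 => /eqP /= m1; move: m_gt2; rewrite m1.
  exists (- 1) => _; have -> : -1 = (- delta k j) k j.
    by rewrite -[RHS]/(- (delta k j k j)) /delta !eqxx.
  apply: red => //; first by move=> i; rewrite -[LHS]/(- (delta k j k.+1 i)) d1.
  have := hFE j jk; rewrite (@coefF_cong _ m v m_gt2 m_odd c c') //.
  by move/(mulfI F1).
have {}point := choice point; have [e he] := point.
have PP : P c = P c'.
  apply: (@monic_prod_determined s _ _ (fun j => qpow m (tr c k j + (e j)%:~R)
    ^+ 2) k).
  - by rewrite /s size_iota subn1.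
  - by rewrite !prodrXl prodw.
  - by move=> j jk; split; [rewrite expf_neq0 // qpow_neq0 | exact: he].
  - move=> i j ik jk xij; apply/eqP/contraT => ij.
    case: (@v_gen k i j) => //; try by split; lia.
    apply: (@qpow_tr_half _ m v m_gt2 c _ _ _ _ (e i - e j)).
    have -> : tr c k i - tr c k j + (e i - e j)%:~R =
        (tr c k i + (e i)%:~R) - (tr c k j + (e j)%:~R) by rewrite rmorphB /=; ring.
    by rewrite qpowD qpowN exprMn xij -exprMn divff ?qpow_neq0 ?expr1n.
have Pmap z : P z = \prod_(a <- [seq qpow m (w z i) ^+ 2 | i <- s]) ('X - a%:P).
  by rewrite big_map.
(* Each root of one polynomial is a root of the other, and genericity of row k+1 forces the two
   indices to be equal. *)
move=> i ik.
have : root (P c') (qpow m (w c i) ^+ 2).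
  rewrite -PP Pmap root_prod_XsubC; apply/mapP; exists i => //;
    rewrite mem_index_iota; lia.
rewrite Pmap root_prod_XsubC => /mapP[l]; rewrite mem_index_iota => lk wil.
have e1 : qpow m (w c i - w c' l) ^+ 2 = 1.
  by rewrite qpowD qpowN exprMn wil -exprMn divff ?qpow_neq0 ?expr1n.
have il : i = l.
  apply/eqP/contraT => il; case: (@v_gen k.+1 i l) => //; try by split; lia.
  apply: (@qpow_tr_half _ m v m_gt2 c _ _ _ _ (c k.+1 l - c' k.+1 l)).
  by rewrite -[RHS]e1 /w /translate rmorphB /=; congr (qpow _ _ ^+ _); ring.
have {e1} : qpow m (c k.+1 i - c' k.+1 i)%:~R ^+ 2 = 1 :> R[i].
  rewrite -[RHS]e1 -il /w /translate rmorphB /=; congr (qpow _ _ ^+ _); ring.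
by move/eqP; rewrite qpow_int_sqr // -rpredN opprB.
Qed.
End RowDetermined.

(** * Projections onto residue classes *)

Section Projections.
Variables (R : realType) (n m : nat) (v : nat -> nat -> R[i]).
Variables (A : pzRingType) (cst : R[i] -> A) (V : lmodType A) (T : array -> V).
Hypotheses (m_gt2 : (2 < m)%N) (m_odd : odd m).
Hypotheses (v_gen : generic n v) (vA : conventionA n v) (vB : conventionB n v).
Hypothesis GT : GT_action n m v cst T.
Local Notation tr := (translate v).
Local Notation Lam := (int_shift n).
Local Notation sc := (@scal _ A cst V).
Implicit Types (z c d : array) (a : A) (Z : seq array).

Definition diagonal_on Z a (f : array -> R[i]) :=
  forall z, z \in Z -> a *: T z = sc (f z) (T z).

(** A projection is only realised on a finite list Z of basis vectors; vectors have finite support,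
    so this suffices. *)
Definition projects_on k Z c a := forall z, z \in Z ->
  a *: T z = if `[< cong_upto m k c z >] then T z else 0.

Definition has_projections k := forall Z c,
  (forall z, z \in Z -> Lam z) -> exists a, projects_on k Z c a.

(** Multiply one separating diagonal operator for each element of Z outside the class: the product
    acts by 1 on the class and by 0 on the rest of Z. *)
Lemma projection_of_separation k Z c :
  (forall c', c' \in Z -> ~ cong_upto m k c c' -> exists a f,
    [/\ diagonal_on Z a f, forall z, cong_upto m k c z -> f z = 1 & f c' = 0]) ->
  exists a, projects_on k Z c a.
Proof.
move=> sep.
have : forall S : seq array, {subset S <= Z} -> exists a f,
    [/\ diagonal_on Z a f, forall z, cong_upto m k c z -> f z = 1
      & forall z, z \in S -> ~ cong_upto m k c z -> f z = 0].
  elim=> [|c' S IH] SZ.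
    exists 1, (fun => 1); split=> // z _.
    by rewrite scale1r (sc1 (actC GT)).
  have [|a [f [af f1 f0]]] := IH; first by move=> z zS; apply: SZ;
    rewrite inE zS orbT.
  have [cc|ncc] := pselect (cong_upto m k c c').
    exists a, f; split=> // z; rewrite inE => /orP[/eqP -> //|]; exact: f0.
  have [|a' [f' [af' f1' f0']]] := sep c' _ ncc; first by apply: SZ;
    exact: mem_head.
  exists (a' * a), (fun z => f z * f' z); split=> [z zZ|z cz|z].
  - by rewrite -scalerA af // (scC (actC GT)) af' // (scA (actC GT)).
  - by rewrite f1 // f1' // mulr1.
  - rewrite inE => /orP[/eqP -> _|zS nz]; first by rewrite f0' mulr0.
    by rewrite f0 // mul0r.
move=> /(_ Z (fun _ => id))[a [f [af f1 f0]]]; exists a => z zZ; rewrite af //.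
case: asboolP => cz; first by rewrite f1 // (sc1 (actC GT)).
by rewrite f0 // (sc0 (actC GT)).
Qed.

Lemma has_projections0 : has_projections 0.
Proof.
move=> Z c hZ; exists 1 => z zZ; rewrite scale1r; case: asboolP => // -[].
by move=> a; rewrite leqn0 => /eqP -> j; lia.
Qed.

(** Unit steps in different columns of row k lead from one class to different classes, as m does not
    divide 1. *)
Lemma cong_upto_shift k c z (e : nat -> array) (s : int) j l :
  (1 <= j <= k)%N -> (1 <= l <= k)%N -> (s == 1) || (s == -1) ->
  (forall i, e i = (fun p r : nat => s * delta k i p r)) -> cong_upto m k c z ->
  cong_upto m k (c + e j) (z + e l) <-> l = j.
Proof.
move=> jk lk s1 he cz; split=> [|->]; last exact: cong_uptoD.
move=> /(_ k (leqnn k) j jk) h; apply/eqP/contraT => lj.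
have : (m %| 1)%Z.
  have mcz := cz k (leqnn k) j jk.
  have : (m %| s)%Z.
    have -> : s = z k j - c k j - ((z + e l) k j - (c + e j) k j).
      rewrite -[(z + e l) k j]/(z k j + e l k j) -[(c + e j) k j]/(c k j + e j k j).
      by rewrite !he /delta !eqxx [j == l]eq_sym (negPf lj) mulr0 mulr1; ring.
    exact: rpredB.
  by case/orP: s1 => /eqP ->; rewrite ?rpredN.
by rewrite dvdz1 => /eqP /= m1; move: m_gt2; rewrite m1.
Qed.

(** Project onto the class of c, apply E_k or F_k, and project onto the class of c + e(j): only the
    arrow in column j survives. *)
Lemma single_arrow k j x (cf : array -> nat -> R[i]) (e : nat -> array) (s : int) :
  has_projections k -> position n.-1 k j ->
  (s == 1) || (s == -1) -> (forall i, e i = (fun p r : nat => s * delta k i p r)) ->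
  (forall z, Lam z -> x *: T z = \sum_(1 <= l < k.+1) sc (cf z l) (T (z + e l))) ->
  forall Z c, (forall z, z \in Z -> Lam z) -> exists a, forall z, z \in Z ->
    a *: T z = if `[< cong_upto m k c z >] then sc (cf z j) (T (z + e j)) else 0.
Proof.
move=> hp pos s1 he xT Z c hZ; have [jk kn] := pos.
have he' l : (1 <= l <= k)%N -> Lam (e l).
  move=> lk p r npr; rewrite he; have := int_shift_delta (n := n) (k := k) (j := l).
  by move=> ->; rewrite ?mulr0.
have [a1 p1] := hp Z c hZ.
have [|a2 p2] := hp [seq z + e l | z <- Z, l <- index_iota 1 k.+1] (c + e j).
  move=> _ /allpairsP[[z l] /= [zZ + ->]]; rewrite mem_index_iota => lk.
  by apply: int_shiftD; [exact: hZ | exact: he'].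
exists (a2 * x * a1) => z zZ; rewrite -!scalerA p1 //; case: asboolP => cz;
  last by rewrite !scaler0.
rewrite xT; last exact: hZ.
rewrite scaler_sumr.
transitivity (\sum_(1 <= l < k.+1 | l == j) sc (cf z l) (T (z + e l))); last first.
  by rewrite big_nat1_eq jk.
rewrite [RHS]big_mkcond; apply: eq_big_nat => l lk.
rewrite (scC (actC GT)) p2; last first.
  by apply/allpairsP; exists (z, l); split=> //; rewrite mem_index_iota.
have sh := cong_upto_shift jk lk s1 he cz.
by case: asboolP => [/sh ->|h]; [rewrite eqxx | case: eqP => [/sh //|_];
  rewrite scr0].
Qed.

Lemma arrowE k j : has_projections k -> position n.-1 k j ->
  forall Z c, (forall z, z \in Z -> Lam z) -> exists a, forall z, z \in Z ->
    a *: T z = if `[< cong_upto m k c z >]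
      then sc (coefE m (tr z) k j) (T (z + delta k j)) else 0.
Proof.
move=> hp pos; have [jk kn] := pos; have [|x xE] := act_E GT (k := k); first lia.
apply: (single_arrow hp pos (s := 1) (e := delta k) _ _ xE) => // l.
by apply/funext => p; apply/funext => r; rewrite mul1r.
Qed.

Lemma arrowF k j : has_projections k -> position n.-1 k j ->
  forall Z c, (forall z, z \in Z -> Lam z) -> exists a, forall z, z \in Z ->
    a *: T z = if `[< cong_upto m k c z >]
      then sc (coefF m (tr z) k j) (T (z - delta k j)) else 0.
Proof.
move=> hp pos; have [jk kn] := pos; have [|x xF] := act_F GT (k := k); first lia.
apply: (single_arrow hp pos (s := -1) (e := fun j => - delta k j) _ _ xF) => // l.
by apply/funext => p; apply/funext => r; rewrite mulN1r.
Qed.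

(** If c and c' could not be separated, K_(k+1) and all loops at row k would have equal eigenvalues
    at both, and [row_determined] would put them in the same class. *)
Lemma has_projectionsS k : (k < n.-1)%N -> has_projections k ->
  has_projections k.+1.
Proof.
move=> kn hp Z c hZ; apply: projection_of_separation => c' c'Z ncc.
have [cc|nk] := pselect (cong_upto m k c c'); last first.
  have [a pa] := hp Z c hZ.
  exists a, (fun z => if `[< cong_upto m k c z >] then 1 else 0);
    split=> [z zZ|z cz|].
  - by rewrite pa //; case: ifP => _; rewrite ?(sc1 (actC GT)) ?(sc0 (actC GT)).
  - by rewrite asboolT // => a' ak; apply: cz; exact: leqW.
  - by rewrite asboolF.
suff [a [f [af fc fcc]]] : exists a f,
    [/\ diagonal_on Z a f, forall z, cong_upto m k.+1 c z ->
      f z = f c & f c != f c'].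
  (* Affine normalisation of f: value 1 on the class of c and 0 at c'. *)
  exists (cst (f c - f c')^-1 * (a + cst (- f c'))).
  exists (fun z => (f c - f c')^-1 * (f z - f c')); split=> [z zZ|z cz|].
  - rewrite -scalerA scalerDl af // -[cst _ *: T z]/(sc (- f c') (T z)).
    by rewrite -(scDl (actC GT)) -[LHS]/(sc _ (sc _ _)) (scA (actC GT)).
  - by rewrite (fc z cz) mulVf ?subr_eq0.
  - by rewrite subrr mulr0.
apply: contrapT => nex.
have agree a f : diagonal_on Z a f -> (forall z, cong_upto m k.+1 c z ->
  f z = f c) ->
    f c = f c'.
  by move=> af fc; apply/eqP/contraT => fcc; case: nex; exists a, f.
have restr z : cong_upto m k.+1 c z -> cong_upto m k c z.
  by move=> cz a' ak; apply: cz; exact: leqW.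
apply: ncc => b; rewrite leq_eqVlt ltnS => /orP[/eqP ->|]; last exact: cc.
have ccc : cong_upto m k c c by move=> p _ r _; rewrite subrr dvdz0.
apply: (row_determined m_gt2 m_odd v_gen vA vB kn cc).
- have [|a aK] := act_K GT (k := k.+1); first lia.
  apply: (agree a (fun z => qpow m (weight (tr z) k.+1))).
    by move=> z zZ; apply: aK; exact: hZ.
  by move=> z cz; apply: weight_cong => //; [exact: cz | apply: cz; exact: leqnSn].
(* The loop F E at (k, j), restricted to the class of c, is diagonal, and its eigenvalue depends
   only on rows up to k+1 modulo m. The loop E F is handled likewise in the last case. *)
- move=> j jk; have pos : position n.-1 k j by split=> //; lia.
  have [a1 h1] := arrowE hp pos c hZ.
  have [|a2 h2] := @arrowF _ _ hp pos [seq z + delta k j | z <- Z] (c + delta k j).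
    by move=> _ /mapP[z zZ ->]; apply: int_shiftD;
      [exact: hZ | exact: int_shift_delta].
  pose f z := if `[< cong_upto m k c z >] then
    coefE m (tr z) k j * coefF m (tr (z + delta k j)) k j else 0.
  have fE z : cong_upto m k c z ->
      f z = coefE m (tr z) k j * coefF m (tr (z + delta k j)) k j.
    by move=> cz; rewrite /f asboolT.
  rewrite -(fE c ccc) -(fE c' cc); apply: (agree (a2 * a1)) => [z zZ|z cz].
    rewrite -scalerA h1 // /f; case: asboolP => cz;
      last by rewrite scaler0 (sc0 (actC GT)).
    rewrite (scC (actC GT)) h2 ?(map_f (fun z => z + delta k j)) // asboolT;
      last exact: cong_uptoD.
    by rewrite (scA (actC GT)) addrK.
  have ck := restr _ cz; rewrite (fE c ccc) (fE z ck); congr (_ * _).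
    by apply: coefE_cong => //; [exact: ck | exact: cz].
  apply: coefF_cong => //; apply: (cong_uptoD _ ck) => //; exact: leq_pred.
- move=> j jk; have pos : position n.-1 k j by split=> //; lia.
  have [a1 h1] := arrowF hp pos c hZ.
  have [|a2 h2] := @arrowE _ _ hp pos [seq z - delta k j | z <- Z] (c - delta k j).
    move=> _ /mapP[z zZ ->]; apply: int_shiftD; first exact: hZ.
    by apply: int_shiftN; exact: int_shift_delta.
  pose f z := if `[< cong_upto m k c z >] then
    coefF m (tr z) k j * coefE m (tr (z - delta k j)) k j else 0.
  have fE z : cong_upto m k c z ->
      f z = coefF m (tr z) k j * coefE m (tr (z - delta k j)) k j.
    by move=> cz; rewrite /f asboolT.
  rewrite -(fE c ccc) -(fE c' cc); apply: (agree (a2 * a1)) => [z zZ|z cz].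
    rewrite -scalerA h1 // /f; case: asboolP => cz;
      last by rewrite scaler0 (sc0 (actC GT)).
    rewrite (scC (actC GT)) h2 ?(map_f (fun z => z - delta k j)) // asboolT;
      last exact: cong_uptoD.
    by rewrite (scA (actC GT)) subrK.
  have ck := restr _ cz; rewrite (fE c ccc) (fE z ck); congr (_ * _).
    apply: coefF_cong => //; apply: ck => //; exact: leq_pred.
  apply: coefE_cong => //; first exact: (cong_uptoD _ ck).
  exact: (cong_uptoD _ cz).
Qed.

Lemma has_projections_le k : (k <= n.-1)%N -> has_projections k.
Proof.
elim: k => [_|k IH kn]; first exact: has_projections0.
by apply: has_projectionsS => //; apply: IH; exact: ltnW.
Qed.

Lemma raise_basis z k j : Lam z -> position n.-1 k j -> coefE m (tr z) k j != 0 ->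
  exists a, T (z + delta k j) = a *: T z.
Proof.
move=> hz pos nz; have [jk kn] := pos.
have [|a ha] := arrowE (has_projections_le kn) pos (Z := [:: z]) z.
  by move=> y; rewrite inE => /eqP ->.
exists (cst (coefE m (tr z) k j)^-1 * a); rewrite -scalerA ha ?mem_head // asboolT.
  by rewrite -/(scal _ _ _) (scA (actC GT)) mulVf // (sc1 (actC GT)).
by move=> i _ l _; rewrite subrr.
Qed.

Lemma lower_basis z k j : Lam z -> position n.-1 k j -> coefF m (tr z) k j != 0 ->
  exists a, T (z - delta k j) = a *: T z.
Proof.
move=> hz pos nz; have [jk kn] := pos.
have [|a ha] := arrowF (has_projections_le kn) pos (Z := [:: z]) z.
  by move=> y; rewrite inE => /eqP ->.
exists (cst (coefF m (tr z) k j)^-1 * a); rewrite -scalerA ha ?mem_head // asboolT.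
  by rewrite -/(scal _ _ _) (scA (actC GT)) mulVf // (sc1 (actC GT)).
by move=> i _ l _; rewrite subrr.
Qed.
End Projections.

(** * Heights and moves along chains *)

Section Heights.
Variables (R : realType) (n m : nat) (v : nat -> nat -> R[i]).
Local Notation Lam := (int_shift n).
Local Notation bottom := (chain_bottom v).
Implicit Types (z d : array) (s : int).

Definition height z k j : int := (if linked v k j then z k.+1 j else 0) - z k j.

Definition box lo hi j : array := fun a b => ((b == j) && (lo <= a < hi)%N)%:Z.

(** The chain of (k, j) lowered by s as a whole; s = m gives the array in the generators of W. *)
Definition shift_height z k j s : array := fun a b =>
  z a b - s * box (bottom k j) k.+1 j a b.

Lemma boxS lo hi j : (lo <= hi)%N -> box lo hi.+1 j = box lo hi j + delta hi j.
Proof.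
move=> lh; apply/funext => a; apply/funext => b.
rewrite -[RHS]/(box lo hi j a b + delta hi j a b) /box /delta.
by case: (b == j); rewrite ?andbF ?andbT //=; case: eqP => [->|]; lia.
Qed.

Lemma box_consl lo hi j : (lo < hi)%N -> box lo hi j = delta lo j + box lo.+1 hi j.
Proof.
move=> lh; apply/funext => a; apply/funext => b.
rewrite -[RHS]/(delta lo j a b + box lo.+1 hi j a b) /box /delta.
by case: (b == j); rewrite ?andbF ?andbT //=; case: eqP => [->|]; lia.
Qed.

Lemma box_nil lo j : box lo lo j = 0.
Proof. by apply/funext => a; apply/funext => b; rewrite /box; lia. Qed.

Lemma box_sum lo hi j a b : (lo <= hi)%N ->
  \sum_(lo <= l < hi) delta l j a b = box lo hi j a b.
Proof.
move=> /subnK <-; elim: (hi - lo)%N => [|i IH].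
  by rewrite add0n big_geq // box_nil.
by rewrite addSn big_nat_recr ?leq_addl //= IH boxS ?leq_addl.
Qed.

Lemma bottom_bounds k j : (1 <= j <= k)%N -> (j <= bottom k j <= k)%N.
Proof. by case/(chain_bottomP v). Qed.

Lemma linked_above_bottom k j l : (1 <= j <= k)%N -> (bottom k j <= l < k)%N ->
  linked v l j.
Proof.
move=> /(chain_bottomP v)[_ vl _] hl; rewrite /linked !vl //; lia.
Qed.

Lemma linked_below_bottom k j : (1 <= j <= k)%N -> (j < bottom k j)%N ->
  linked v (bottom k j).-1 j = false.
Proof.
move=> jk jt; have [_ _ [|ne]] := chain_bottomP v jk; first lia.
by apply/eqP; rewrite prednK; [move=> /esym | lia].
Qed.

Lemma mv_drop z k j : (1 <= j <= k)%N -> shift_height z k j m =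
  z + chain_drop m v k j.
Proof.
move=> jk; have := bottom_bounds jk => tk.
apply/funext => a; apply/funext => b; rewrite /shift_height /chain_drop.
rewrite -[RHS]/(z a b + - (m%:Z * \sum_(bottom k j <= l < k.+1) delta l j a b)).
by rewrite box_sum //; lia.
Qed.

Lemma mv0 z k j : shift_height z k j 0 = z.
Proof. by apply/funext => a; apply/funext => b;
  rewrite /shift_height mul0r subr0. Qed.

Lemma mvD z k j s s' : shift_height (shift_height z k j s) k j s' =
  shift_height z k j (s + s').
Proof. by apply/funext => a; apply/funext => b;
  rewrite /shift_height mulrDl opprD addrA. Qed.

Lemma int_shift_box lo hi j : (1 <= j <= lo)%N -> (hi <= n)%N -> Lam (box lo hi j).
Proof.
move=> jl hn a b nab; rewrite /box; case: eqP => //= bj;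
  case: (boolP (_ <= _ < _)%N) => //= /andP[la ah].
by case: nab; split; lia.
Qed.

Lemma int_shift_mv z k j s : position n.-1 k j -> Lam z ->
  Lam (shift_height z k j s).
Proof.
move=> [jk kn] hz a b nab; rewrite /shift_height hz // sub0r.
have tk := bottom_bounds jk.
have hbox : Lam (box (bottom k j) k.+1 j) by apply: int_shift_box; lia.
by rewrite hbox // mulr0 oppr0.
Qed.

(** Inside the chain both terms of a height drop together. Under its bottom the position is unlinked
    and does not see the change, so only the top of the chain does. *)
Lemma height_mv z k j s a b : (1 <= j <= k)%N -> (1 <= b <= a)%N ->
  height (shift_height z k j s) a b = height z a b + (if (a == k) && (b == j)
    then s else 0).
Proof.
move=> jk ba; have /andP[jt tk] := bottom_bounds jk.
rewrite /height /shift_height /box; have [bj|nbj] := eqVneq b j; last first.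
  by rewrite ?andbF /=; case: ifP => _; lia.
rewrite {}bj in ba *; rewrite andbT /=.
have [ak|nak] := eqVneq a k.
  have [-> ->] : (bottom k j <= a.+1 < k.+1)%N = false /\
    (bottom k j <= a < k.+1)%N.
    by split; lia.
  by case: ifP => _ /=; lia.
have [ta|at'] := leqP (bottom k j) a; last first.
  have [ta1|ta1] := leqP (bottom k j) a.+1; last by case: ifP => _ /=; lia.
  have e : a = (bottom k j).-1 by lia.
  by rewrite [X in linked v X]e linked_below_bottom //=; lia.
have [ak|ka] := ltnP a k; last by case: ifP => _ /=; lia.
rewrite (linked_above_bottom jk) /= ?ta ?ak //.
have [-> ->] : (a.+1 < k.+1)%N /\ (a < k.+1)%N by split; lia.
by rewrite leqW //=; lia.
Qed.

(** Both arrays vanish on row n, and heights recover each row from the one above it. *)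
Lemma height_inj z z' : Lam z -> Lam z' ->
  (forall k j, position n.-1 k j -> height z k j = height z' k j) -> z = z'.
Proof.
move=> hz hz' zz; apply/funext => a; apply/funext => b.
have [r] := ubnP (n - a)%N; elim: r => // r IH in a *; rewrite ltnS => ar.
have [pos|npos] := pselect (position n.-1 a b); last by rewrite hz // hz'.
have e : z a.+1 b = z' a.+1 b by apply: IH; case: pos; lia.
by have := zz a b pos; rewrite /height e => /addrI/oppr_inj.
Qed.

Lemma height0 k j : height 0 k j = 0.
Proof. by rewrite /height; case: ifP. Qed.

Lemma height_linked z k j : linked v k j -> height z k j = z k.+1 j - z k j.
Proof. by rewrite /height => ->. Qed.

Lemma height_cong z z' k j : Lam z -> Lam z' -> cong_upto m n.-1 z z' ->
  position n.-1 k j ->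
  (m %| height z' k j - height z k j)%Z.
Proof.
move=> hz hz' zz' [jk kn].
have h1 := zz' k kn j jk.
have h2 : (m %| (if linked v k j then z' k.+1 j else 0%R) -
                (if linked v k j then z k.+1 j else 0%R))%Z.
  case: ifP => _; last by rewrite subrr.
  have [kn1|nk] := leqP k.+1 n.-1; first by apply: zz' => //; lia.
  by rewrite hz' ?hz ?subrr //; case; lia.
rewrite /height; move: h2; set x := if _ then _ else _;
  set y := if _ then _ else _ => h2.
have -> : x - z' k j - (y - z k j) = (x - y) - (z' k j - z k j) by ring.
exact: rpredB.
Qed.

Definition positions := undup [seq (k, j) | k <- iota 1 n.-1, j <- iota 1 k].

Lemma mem_positions k j : ((k, j) \in positions) <-> position n.-1 k j.
Proof.
rewrite mem_undup; split=> [/allpairsPdep[a [b [ha hb [-> ->]]]]|[jk kn]].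
  by move: ha hb; rewrite !mem_iota /position; lia.
by apply/allpairsPdep; exists k, j; rewrite !mem_iota; split=> //; lia.
Qed.

(** A chain move changes a single height, so z can be deformed into z' one position at a time. The
    order L is left free because the proof runs through the rows in both directions. *)
Lemma path_ind (L : seq (nat * nat)) (P : array -> Prop) z z' :
  uniq L -> (forall k j, (k, j) \in L <-> position n.-1 k j) ->
  Lam z -> Lam z' ->
  (forall pre k j suf y, L = pre ++ (k, j) :: suf -> position n.-1 k j -> Lam y ->
    (forall a b, (a, b) \in pre -> height y a b = height z' a b) ->
    (forall a b, (a, b) \in (k, j) :: suf -> height y a b = height z a b) ->
    P y -> P (shift_height y k j (height z' k j - height z k j))) ->
  P z -> P z'.
Proof.
move=> uL memL hz hz' step Pz.
suff : forall suf pre y, L = pre ++ suf -> Lam y ->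
    (forall a b, (a, b) \in pre -> height y a b = height z' a b) ->
    (forall a b, (a, b) \in suf -> height y a b = height z a b) -> P y -> P z'.
  by move=> /(_ L [::] z erefl hz); apply.
elim=> [|[k j] suf IH] pre y eL hy hpre hsuf Py.
  suff -> : z' = y by [].
  apply: height_inj => // k j /memL; rewrite eL cats0 => /hpre -> //.
have pos : position n.-1 k j by apply/memL; rewrite eL mem_cat mem_head orbT.
have posL a b : (a, b) \in pre ++ (k, j) :: suf -> (1 <= b <= a)%N.
  by rewrite -eL => /memL[].
have [jk _] := pos.
apply: (IH (rcons pre (k, j)) (shift_height y k j (height z' k j - height z k j))).
- by rewrite cat_rcons.
- exact: int_shift_mv.
- move=> a b; rewrite mem_rcons inE => /orP[/eqP[-> ->]|ab].
    by rewrite height_mv // !eqxx /= hsuf ?mem_head // addrC subrK.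
  rewrite height_mv //; last by apply: posL; rewrite mem_cat ab.
  case: ifP => [/andP[/eqP ak /eqP bj]|_]; last by rewrite addr0 hpre.
  move: uL; rewrite eL cat_uniq => /and3P[_ /hasPn/(_ (k, j) (mem_head _ _))].
  by rewrite /= -ak -bj ab.
- move=> a b ab; rewrite height_mv //; last first.
    by apply: posL; rewrite mem_cat inE ab !orbT.
  case: ifP => [/andP[/eqP ak /eqP bj]|_]; last by rewrite addr0 hsuf // inE ab
    orbT.
  move: uL; rewrite eL cat_uniq => /and3P[_ _ /= /andP[]].
  by rewrite -ak -bj ab.
- exact: step eL pos hy hpre hsuf Py.
Qed.

Definition upward := sort (fun p q : nat * nat => (p.1 <= q.1)%N) positions.

Lemma mem_upward k j : ((k, j) \in upward) <-> position n.-1 k j.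
Proof. by rewrite mem_sort mem_positions. Qed.

Lemma upward_uniq : uniq upward.
Proof. by rewrite sort_uniq undup_uniq. Qed.

Lemma upward_split pre k j suf a b : upward = pre ++ (k, j) :: suf ->
  position n.-1 a b -> (a < k)%N -> (a, b) \in pre.
Proof.
move=> e /mem_upward; rewrite e mem_cat => /orP[//|ab] ak.
have : sorted (fun p q : nat * nat => (p.1 <= q.1)%N) upward.
  by apply: sort_sorted => p q; exact: leq_total.
rewrite sorted_pairwise; last by move=> p q r; exact: leq_trans.
rewrite e pairwise_cat => /and3P[_ _ /= /andP[/allP h _]].
move: ab; rewrite inE => /orP[/eqP[ek _]|/h /=]; lia.
Qed.
End Heights.

(** * Moving chains inside a submodule *)

Section Moves.
Variables (R : realType) (n m : nat) (v : nat -> nat -> R[i]).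
Variables (A : pzRingType) (cst : R[i] -> A) (V : lmodType A) (T : array -> V).
Hypotheses (n_gt1 : (1 < n)%N) (m_gt2 : (2 < m)%N) (m_odd : odd m).
Hypotheses (v_gen : generic n v) (vA : conventionA n v) (vB : conventionB n v).
Hypothesis GT : GT_action n m v cst T.
Local Notation tr := (translate v).
Local Notation Lam := (int_shift n).
Local Notation bottom := (chain_bottom v).
Local Notation mv := (shift_height v).
Implicit Types (z d : array) (S : submod V) (s : int).

Lemma not_dvd1 : (m %| 1)%Z = false.
Proof. by rewrite dvdz1 /=; lia. Qed.

Lemma submod_raise S z k j : Lam z -> position n.-1 k j ->
  ~ (linked v k j /\ barrier n m v z k j) ->
  submod_set S (T z) -> submod_set S (T (z + delta k j)).
Proof.
move=> hz pos nb; have [|a ->] := raise_basis m_gt2 m_odd v_gen vA vB GT hz pos.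
  by apply/eqP => /(coefE_eq0 m_gt2 m_odd v_gen vA vB hz pos).
exact: submodZ.
Qed.

Lemma submod_lower S z k j : Lam z -> position n.-1 k j ->
  ~ [/\ (j < k)%N, linked v k.-1 j & (m %| z k j - z k.-1 j)%Z] ->
  submod_set S (T z) -> submod_set S (T (z - delta k j)).
Proof.
move=> hz pos nb; have [|a ->] := lower_basis m_gt2 m_odd v_gen vA vB GT hz pos.
  by apply/eqP => /(coefF_eq0 m_gt2 m_odd v_gen vA vB pos).
exact: submodZ.
Qed.

(** All entries of the chain of (k, j) have then the same shift, and the chain can be moved one
    entry at a time. *)
Definition zero_below z k j := forall l, (bottom k j <= l < k)%N ->
  height v z l j = 0.

Lemma mv1E z k j : mv z k j 1 = z - box (bottom k j) k.+1 j.
Proof. by apply/funext => a; apply/funext => b; rewrite /shift_height mul1r. Qed.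

Lemma mvN1E z k j : mv z k j (- 1) = z + box (bottom k j) k.+1 j.
Proof. by apply/funext => a; apply/funext => b;
  rewrite /shift_height mulN1r opprK. Qed.

(** Entries are lowered from the bottom up. The bottom is not linked downwards, and every later
    entry exceeds the one just lowered by 1, so no lowering coefficient vanishes. *)
Lemma submod_lower_chain S z k j : Lam z -> position n.-1 k j -> zero_below z k j ->
  submod_set S (T z) -> submod_set S (T (mv z k j 1)).
Proof.
move=> hz pos zb Sz; have [jk kn] := pos; have /andP[jt tk] := bottom_bounds v jk.
rewrite mv1E; set t := bottom k j in zb jt tk *.
have : forall i, (i <= k.+1 - t)%N -> submod_set S (T (z - box t (t + i) j)).
  elim=> [|i IH] ik; first by rewrite addn0 box_nil subr0.
  have {}IH := IH (ltnW ik).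
  rewrite addnS boxS ?leq_addr // opprD addrA; apply: submod_lower => //.
  - apply: int_shiftD => //; apply: int_shiftN.
    by apply: int_shift_box; lia.
  - by split; lia.
  case=> jl lk.
  have -> : (z - box t (t + i) j) (t + i) j = z (t + i)%N j.
    by rewrite -[LHS]/(z (t + i)%N j - box t (t + i) j (t + i) j) /box ltnn
      !andbF subr0.
  rewrite -[(z - _) _ j]/(z (t + i).-1 j - box t (t + i) j (t + i).-1 j) /box
    eqxx /=.
  case: i => [|i] in ik IH lk jl *.
    by rewrite addn0 linked_below_bottom in lk; lia.
  rewrite addnS /= leq_addr ltnSn /= => hd.
  have := zb (t + i)%N; rewrite height_linked; last by rewrite addnS in lk.
  move=> h0; have {}h0 : z (t + i).+1 j - z (t + i)%N j = 0 by apply: h0; lia.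
  by move: hd; rewrite opprB addrCA h0 addr0 not_dvd1.
move=> /(_ _ (leqnn _)); rewrite subnKC //; lia.
Qed.

(** Entries are raised from the top down. Below the top each entry differs by 1 from the one just
    raised, so a barrier can occur only at (k, j) itself. *)
Lemma submod_raise_chain S z k j : Lam z -> position n.-1 k j -> zero_below z k j ->
  ~ (linked v k j /\ barrier n m v z k j) ->
  submod_set S (T z) -> submod_set S (T (mv z k j (- 1))).
Proof.
move=> hz pos zb nb Sz; have [jk kn] := pos; have /andP[jt tk] := bottom_bounds
  v jk.
rewrite mvN1E; set t := bottom k j in zb jt tk *.
have : forall i, (i <= k.+1 - t)%N -> submod_set S (T (z + box (k.+1 - i) k.+1 j)).
  elim=> [|i IH] ik; first by rewrite subn0 box_nil addr0.
  have {}IH := IH (ltnW ik).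
  set l := (k.+1 - i.+1)%N; have el : (k.+1 - i)%N = l.+1 by rewrite /l; lia.
  have ll : (t <= l <= k)%N by rewrite /l; lia.
  rewrite (@box_consl l) ?ltnS; last by lia.
  rewrite [delta _ _ + _]addrC addrA -el; apply: submod_raise => //.
  - by apply: int_shiftD => //; apply: int_shift_box; lia.
  - by split; lia.
  rewrite {}el in IH *.
  have [lk|kl] := ltnP l k; last first.
    have -> : l = k by lia.
    by rewrite box_nil addr0.
  move=> [lkd [hd|[ln _]]]; last by lia.
  have := zb l; rewrite height_linked // => h0.
  have {}h0 : z l.+1 j - z l j = 0 by apply: h0; lia.
  move: hd; rewrite -[(z + _) l j]/(z l j + box l.+1 k.+1 j l j).
  rewrite -[(z + _) l.+1 j]/(z l.+1 j + box l.+1 k.+1 j l.+1 j) /box eqxx ltnn /=.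
  rewrite leqnn ltnS lk /= => hd; move: not_dvd1; rewrite -rpredN.
  have -> : - 1%:Z = z l j + 0 - (z l.+1 j + 1) + (z l.+1 j - z l j) by ring.
  by rewrite h0 addr0 hd.
move=> /(_ (k.+1 - t)%N (leqnn _)); have -> // : (k.+1 - (k.+1 - t))%N = t by lia.
Qed.

Lemma zero_below_mv z k j s : (1 <= j <= k)%N -> zero_below z k j ->
  zero_below (mv z k j s) k j.
Proof.
move=> jk zb l hl; have := bottom_bounds v jk => tk.
rewrite height_mv //; last by lia.
by rewrite zb // ltn_eqF //; lia.
Qed.

Lemma submod_lower_chainn S z k j (r : nat) : Lam z -> position n.-1 k j ->
  zero_below z k j -> submod_set S (T z) -> submod_set S (T (mv z k j r)).
Proof.
move=> hz pos zb Sz; elim: r => [|r IH]; first by rewrite mv0.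
rewrite -addn1 PoszD -mvD; apply: submod_lower_chain => //.
- exact: int_shift_mv.
- by apply: zero_below_mv => //; case: pos.
Qed.

Lemma submod_raise_chainn S z k j (r : nat) : Lam z -> position n.-1 k j ->
  zero_below z k j ->
  (forall i : nat, (i < r)%N -> ~ (linked v k j /\
    barrier n m v (mv z k j (- i%:Z)) k j)) ->
  submod_set S (T z) -> submod_set S (T (mv z k j (- r%:Z))).
Proof.
move=> hz pos zb nb Sz; elim: r nb => [|r IH] nb; first by rewrite oppr0 mv0.
rewrite -addn1 PoszD opprD -mvD; apply: submod_raise_chain => //.
- exact: int_shift_mv.
- by apply: zero_below_mv => //; case: pos.
- exact: nb.
- by apply: IH => i ir; apply: nb; exact: ltnW.
Qed.

Definition dominated z := forall k j, position n.-1 k j -> linked v k j ->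
  0 <= height v z k j.

Lemma dominated0 : dominated 0.
Proof. by move=> k j _ _; rewrite height0. Qed.

Lemma delta_eq k j a b : delta k j a b = ((a == k) && (b == j))%:Z.
Proof. by []. Qed.

(** The height at a linked (a, b) decreases only by raising z at (a, b) or lowering it at (a+1, b),
    and both coefficients vanish when that height is 0. *)
Lemma dominated_stable : stable n m v dominated.
Proof.
move=> z k j hz dz [jk kn]; split=> nz a b pos lab; have := dz a b pos lab.
  rewrite !height_linked // => h.
  rewrite -[(z + _) a.+1 b]/(z a.+1 b + delta k j a.+1 b).
  rewrite -[(z + _) a b]/(z a b + delta k j a b) !delta_eq.
  have [ak|] := eqVneq a k; last by case: (_ == _) => /= _; lia.
  have [bj|] := eqVneq b j; last by rewrite !andbF; lia.
  rewrite ak bj in h lab *; rewrite gtn_eqF //= .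
  suff : z k.+1 j - z k j != 0 by lia.
  apply: contraNneq nz => e; apply/eqP; apply: coefE_linked => //.
  by rewrite -opprB e oppr0 dvdz0.
rewrite !height_linked // => h.
rewrite -[(z - _) a.+1 b]/(z a.+1 b - delta k j a.+1 b).
rewrite -[(z - _) a b]/(z a b - delta k j a b) !delta_eq.
have [ak|] := eqVneq a.+1 k; last by case: (_ == _) => /= _; lia.
have [bj|] := eqVneq b j; last by rewrite !andbF; lia.
rewrite -ak in nz *; rewrite bj in h lab *; rewrite ltn_eqF //=.
suff : z a.+1 j - z a j != 0 by lia.
apply: contraNneq nz => e; apply/eqP; apply: coefF_linked => //.
- by case: pos; lia.
- by rewrite /= e dvdz0.
Qed.

Lemma barrierP z k j : Lam z -> position n.-1 k j -> linked v k j ->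
  barrier n m v z k j ->
  (m %| height v z k j)%Z \/ k = n.-1 /\ exists i (d : int),
    [/\ (1 <= i <= n)%N, v n i - v n.-1 j = d%:~R & (m %| height v z k j + d)%Z].
Proof.
move=> hz [jk kn] lk [h|[ek [i [d [hi vd h]]]]]; [left | right; split=> //].
  by rewrite height_linked // -opprB rpredN.
exists i, d; split=> //; rewrite height_linked // ek prednK; last lia.
rewrite [z n j]hz; last by case; lia.
have -> : 0 - z n.-1 j + d = - (z n.-1 j - d) by ring.
by rewrite rpredN -ek.
Qed.

(** Heights are set from row n-1 downwards, so the lower part of each chain still has zero heights.
    Nonnegative heights are reached by lowering; negative ones occur only at unlinked positions,
    where raising meets no barrier. *)
Lemma basis_in_span S z : submod_set S (T 0) -> Lam z -> dominated z ->
  submod_set S (T z).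
Proof.
move=> S0 hz dz.
pose L := rev (upward n).
have memL k j : (k, j) \in L <-> position n.-1 k j.
  by rewrite mem_rev; exact: mem_upward.
apply: (@path_ind _ n v L (fun y => submod_set S (T y)) 0 z) => //.
  by rewrite rev_uniq upward_uniq.
move=> pre k j suf y eL pos hy _ hsuf Sy.
have [jk kn] := pos.
have zb : zero_below y k j.
  move=> l hl; have := bottom_bounds v jk => tk.
  rewrite hsuf ?height0 // inE; apply/orP; right.
  have eU : upward n = rev suf ++ (k, j) :: rev pre.
    by rewrite -[LHS]revK -/L eL rev_cat rev_cons cat_rcons.
  have := upward_split eU (a := l) (b := j); rewrite mem_rev; apply; last lia.
  by split; lia.
rewrite height0 subr0.
case E : (height v z k j) => [r|r]; first exact: submod_lower_chainn.
rewrite NegzE; apply: submod_raise_chainn => // i _ [lk _].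
by have := dz k j pos lk; rewrite E.
Qed.
End Moves.

(** * The quotient *)

Lemma dvdz_small_eq0 (m : nat) (x : int) : (m %| x)%Z -> 0 <= x -> x < m%:Z ->
  x = 0.
Proof.
move=> /dvdz_mod0P mx x0 xm; have e : (x %% m)%Z = x by rewrite modz_small // x0.
exact: etrans (esym e) mx.
Qed.

Section Quotient.
Variables (R : realType) (n m : nat) (v : nat -> nat -> R[i]).
Variables (A : pzRingType) (cst : R[i] -> A) (V : lmodType A) (T : array -> V).
Hypotheses (n_gt1 : (1 < n)%N) (m_gt2 : (2 < m)%N) (m_odd : odd m).
Hypotheses (v_gen : generic n v) (vA : conventionA n v) (vB : conventionB n v).
Hypothesis GT : GT_action n m v cst T.
Variables (W : nat -> nat -> submod V) (N : submod V) (killed : nat -> nat -> Prop).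
Hypothesis W_glued : forall k j, position n.-1 k j -> ~ killed k j ->
  W k j = submod_span [set T (chain_drop m v k j) - T 0]%classic.
Hypothesis W_killed : forall k j, position n.-1 k j -> killed k j ->
  linked v k j /\ W k j = submod_span [set T (chain_drop m v k j)]%classic.
Hypothesis N_W : forall k j x, position n.-1 k j -> submod_set (W k j) x ->
  submod_set N x.
Hypothesis N_ind : forall P : V -> Prop,
  P 0 -> (forall x y, P x -> P y -> P (x + y)) ->
  (forall k j x, position n.-1 k j -> submod_set (W k j) x -> P x) ->
  forall x, submod_set N x -> P x.
Local Notation Lam := (int_shift n).
Local Notation mv := (shift_height v).
Local Notation comb := (lincomb cst T).
Local Notation sc := (@scal _ A cst V).
Local Notation M := (submod_span [set T 0]%classic).
Implicit Types (z d : array) (S : submod V) (s : int).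

Lemma int_shift_drop k j : position n.-1 k j -> Lam (chain_drop m v k j).
Proof.
move=> pos; have [jk _] := pos.
by rewrite -[chain_drop _ _ _ _]add0r -mv_drop //; exact: int_shift_mv.
Qed.

Lemma mult_array_drop k j : mult_array m (chain_drop m v k j).
Proof. by move=> a b; rewrite /chain_drop rpredN dvdz_mulr. Qed.

Lemma supported_basis (Q : array -> Prop) (c : R[i]) z : Q z ->
  supported Q [:: (c, z)].
Proof. by move=> Qz p; rewrite inE => /eqP ->. Qed.

(** The identity a T(z) = T(y) is a relation among basis vectors, and it survives the translation of
    all indices by d. *)
Lemma translate_action a z y d : Lam z -> Lam y -> Lam d -> mult_array m d ->
  a *: T z = T y -> a *: T (z + d) = T (y + d).
Proof.
move=> hz hy hd md e; have [L [sL aL _]] := action m_gt2 m_odd GT a hz.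
have e0 : comb (L ++ [:: (-1, y)]) = 0.
  rewrite lincomb_cat {2}/lincomb big_seq1 /= (scN1 (actC GT)) -e.
  rewrite -[z in _ *: T z]addr0 aL ?shiftcomb0 ?subrr // => i j; exact: dvdz0.
have sL' : supported Lam (L ++ [:: (-1, y)]) by apply: supported_cat => //;
  exact: supported_basis.
have := lincomb_transfer (actC GT) (act_free GT) (fun z => T (z + d)) sL' e0.
rewrite big_cat big_seq1 /= (scN1 (actC GT)) => /eqP; rewrite subr_eq0 => /eqP <-.
by rewrite aL // /lincomb big_map.
Qed.

Lemma basis_in_M z : Lam z -> dominated n v z -> submod_set M (T z).
Proof.
exact: (basis_in_span n_gt1 m_gt2 m_odd v_gen vA vB GT (@submod_span1 _ _ (T 0))).
Qed.

Lemma basis_action z : Lam z -> dominated n v z -> exists a, T z = a *: T 0.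
Proof. by move=> hz dz; apply: submod_span1P; exact: basis_in_M. Qed.

Lemma dominated_mv_linked z k j s : position n.-1 k j ->
  (linked v k j -> 0 <= height v z k j + s) -> dominated n v z ->
    dominated n v (mv z k j s).
Proof.
move=> [jk kn] hs dz a b pos lab; rewrite height_mv //; last by case: pos.
case: ifP => [/andP[/eqP ak /eqP bj]|_]; last by rewrite addr0; exact: dz.
by rewrite ak bj in lab *; exact: hs.
Qed.

Lemma dominated_mv z k j s : position n.-1 k j -> 0 <= height v z k j + s ->
  dominated n v z -> dominated n v (mv z k j s).
Proof. by move=> pos hs; exact: dominated_mv_linked. Qed.

(** Write T(z) = a T(0). Translation gives the same identity after the drop, so the difference is a
    times the generator of W. *)
Lemma glued_rel z k j : Lam z -> dominated n v z -> position n.-1 k j ->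
  ~ killed k j ->
  submod_set N (T (mv z k j m) - T z).
Proof.
move=> hz dz pos nk; have [jk _] := pos; have [a az] := basis_action hz dz.
apply: (N_W pos); rewrite (W_glued pos nk) mv_drop // az.
have := @translate_action a 0 z _ (@int_shift0 n) hz (int_shift_drop pos)
  (@mult_array_drop k j) (esym az).
by rewrite add0r => <-; rewrite -scalerBr; apply: submodZ; exact: submod_span1.
Qed.

Lemma killed_rel z k j : Lam z -> dominated n v z -> position n.-1 k j ->
  killed k j ->
  submod_set N (T (mv z k j m)).
Proof.
move=> hz dz pos kk; have [jk _] := pos; have [a az] := basis_action hz dz.
apply: (N_W pos); have [_ ->] := W_killed pos kk; rewrite mv_drop //.
have := @translate_action a 0 z _ (@int_shift0 n) hz (int_shift_drop pos)
  (@mult_array_drop k j) (esym az).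
by rewrite add0r => <-; apply: submodZ; exact: submod_span1.
Qed.

Lemma glued_rel_nat z k j (r : nat) : Lam z -> dominated n v z ->
  position n.-1 k j ->
  ~ killed k j -> submod_set N (T (mv z k j (m%:Z * r%:Z)) - T z).
Proof.
move=> hz dz pos nk; elim: r => [|r IH].
  by rewrite mulr0 mv0 subrr; exact: submod0.
have -> : m%:Z * r.+1%:Z = m%:Z * r%:Z + m%:Z by rewrite -addn1 PoszD mulrDr mulr1.
rewrite -mvD -[X in X - _](subrK (T (mv z k j (m%:Z * r%:Z)))) -addrA.
apply: submodD => //; apply: glued_rel => //; first exact: int_shift_mv.
by apply: dominated_mv_linked => // lk; have := dz k j pos lk; lia.
Qed.

Lemma glued_rel_int z k j s : Lam z -> dominated n v z ->
  dominated n v (mv z k j (m%:Z * s)) ->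
  position n.-1 k j -> ~ killed k j -> submod_set N (T (mv z k j (m%:Z * s)) - T z).
Proof.
move=> hz dz dz' pos nk; case: s dz' => r dz'; first exact: glued_rel_nat.
rewrite -opprB; rewrite -scaleN1r; apply: submodZ.
have := @glued_rel_nat (mv z k j (m%:Z * Negz r)) k j r.+1 _ dz' pos nk.
rewrite mvD NegzE mulrN addNr mv0; apply; exact: int_shift_mv.
Qed.

Definition in_class (c : nat -> nat -> int) z := forall k j, position n.-1 k j ->
  (killed k j -> height v z k j = c k j) /\
  (~ killed k j -> (m %| height v z k j - c k j)%Z).

(* These functionals vanish on N and separate the classes modulo N. *)
Definition class_sum c : V -> R[i] :=
  coordsum (act_span GT) (fun z => if `[< in_class c z >] then 1 else 0).

Lemma in_class_drop c z k j : position n.-1 k j -> ~ killed k j ->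
  in_class c (z + chain_drop m v k j) <-> in_class c z.
Proof.
move=> pos nk; have [jk _] := pos; rewrite -mv_drop //.
have dvm (x y : int) : (m %| x + m%:Z - y)%Z = (m %| x - y)%Z.
  by rewrite addrAC rpredDr.
split=> h a b pab; have [h1 h2] := h a b pab; have [ba _] := pab; move: h1 h2;
  rewrite height_mv //; case: ifP => [/andP[/eqP -> /eqP ->] _|_];
    rewrite ?addr0 // dvm;
  by move=> h2; split.
Qed.

(** Write a T(0) as a combination of dominated arrays. A glued generator pairs each of them with a
    translate in the same class; a killed one lifts their heights at (k, j) to at least m, while c
    stays below m. *)
Lemma class_sum_N c x : (forall k j, c k j < m%:Z) -> submod_set N x ->
  class_sum c x = 0.
Proof.
move=> cm; pose P x := class_sum c x = 0.
apply: (@N_ind P) => {x} [|x y Px Py|k j x pos Wx].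
- apply: (addrI (class_sum c 0)).
  by rewrite -(coordsumD (actC GT) _ (act_free GT)) !addr0.
- rewrite /P /class_sum (coordsumD (actC GT) _ (act_free GT)).
  by rewrite -/(class_sum c x) -/(class_sum c y) Px Py addr0.
set D := chain_drop m v k j; have hD := int_shift_drop pos;
  have mD := @mult_array_drop k j.
have act a : exists L,
    [/\ supported Lam L, a *: T 0 = comb L, supported Lam (shiftcomb D L),
    a *: T D = comb (shiftcomb D L) & supported (dominated n v) L].
  have [L [sL aL qL]] := action m_gt2 m_odd GT a (@int_shift0 n); exists L;
    split=> //.
  - by rewrite -{1}[0](add0r 0) aL ?shiftcomb0 // => i l; exact: dvdz0.
  - by move=> p /mapP[p' /sL hp ->]; exact: int_shiftD.
  - by rewrite -[D]add0r aL // add0r.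
  - by apply: qL; [exact: dominated_stable | exact: dominated0].
have [kk|nk] := pselect (killed k j).
  have [lk eW] := W_killed pos kk; move: Wx; rewrite eW => /submod_span1P[a ->].
  have [L [sL _ sL' -> dL]] := act a.
  rewrite /P /class_sum (coordsum_lincomb (actC GT) _ (act_free GT)) //
    /evalcomb big_map.
  rewrite big_seq big1 // => p pL; rewrite asboolF ?mulr0 //= =>
    /(_ k j pos)[/(_ kk) + _].
  have [jk _] := pos; rewrite -mv_drop // height_mv // !eqxx /= => e.
  have := cm k j; have := dL p pL k j pos lk; rewrite -e;
    move: (height v _ _ _) => h; lia.
move: Wx; rewrite (W_glued pos nk) => /submod_span1P[a ->].
have [L [sL e sL' e' _]] := act a.
rewrite scalerBr e e' /P /class_sum (coordsumD (actC GT) _ (act_free GT)).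
rewrite (coordsumN (actC GT) _ (act_free GT)).
rewrite !(coordsum_lincomb (actC GT) _ (act_free GT)) //.
apply/eqP; rewrite subr_eq0; apply/eqP; rewrite /evalcomb big_map;
  apply: eq_bigr => p _ /=.
by rewrite (asbool_equiv_eq (in_class_drop c p.2 pos nk)).
Qed.

Lemma class_sum_basis c z : Lam z -> class_sum c (T z) =
  if `[< in_class c z >] then 1 else 0.
Proof.
by move=> hz; rewrite /class_sum (coordsum_basis (actC GT) _ (act_free GT)).
Qed.

Lemma basis_notin_N z : Lam z ->
  (forall k j, position n.-1 k j -> height v z k j < m%:Z) -> ~ submod_set N (T z).
Proof.
(* The value 0 outside the triangle keeps c below m everywhere. *)
move=> hz zm; pose c k j := if `[< position n.-1 k j >] then height v z k j else 0.
have cm k j : c k j < m%:Z by rewrite /c; case: asboolP => [/zm //|_]; lia.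
move=> /(class_sum_N cm)/eqP; rewrite class_sum_basis // asboolT ?oner_eq0 //.
by move=> k j pos; rewrite /c asboolT // subrr dvdz0.
Qed.

Lemma M_supported x : submod_set M x ->
  exists2 L, supported (fun z => Lam z /\ dominated n v z) L & x = comb L.
Proof.
move=> Mx; pose D := span_stable m_gt2 m_odd GT (dominated_stable n_gt1 m_gt2
  m_odd).
suff : submod_set D x by [].
apply: submod_spanE Mx => _ ->; exists [:: (1, 0)].
  by apply: supported_basis; split; [exact: int_shift0 | exact: dominated0].
by rewrite /lincomb big_seq1 /= (sc1 (actC GT)).
Qed.

Definition reduced z := forall k j, position n.-1 k j -> killed k j ->
  height v z k j < m%:Z.

Lemma not_reduced_N z : Lam z -> dominated n v z -> ~ reduced z ->
  submod_set N (T z).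
Proof.
move=> hz dz nr.
have [k [j [pos kk mh]]] : exists k j,
    [/\ position n.-1 k j, killed k j & m%:Z <= height v z k j].
  apply: contrapT => nex; apply: nr => k j pos kk; rewrite ltNge; apply/negP => mh.
  by apply: nex; exists k, j.
rewrite -[z](mv0 v _ k j) -(addNr m%:Z) -mvD; apply: killed_rel => //.
  exact: int_shift_mv.
by apply: dominated_mv => //; lia.
Qed.

(** At a killed position the two heights are congruent and lie in [0, m), hence are equal. At the
    others they differ by a multiple of m, which gluing absorbs. *)
Lemma congruent_rel z z' : Lam z -> Lam z' -> dominated n v z -> dominated n v z' ->
  reduced z -> reduced z' -> cong_upto m n.-1 z z' -> submod_set N (T z' - T z).
Proof.
move=> hz hz' dz dz' rz rz' cz.
suff [] : dominated n v z' /\ submod_set N (T z' - T z) by [].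
apply: (@path_ind _ n v (upward n) (fun y => dominated n v y /\
  submod_set N (T y - T z)) z z' (upward_uniq n) (@mem_upward n) hz hz');
    last first.
  by split; rewrite ?subrr //; exact: submod0.
move=> pre k j suf y eL pos hy _ hsuf [dy Ny].
have hyz : height v y k j = height v z k j by apply: hsuf; exact: mem_head.
have mh := height_cong v hz hz' cz pos.
set s := _ - _ in mh *.
have dy' : dominated n v (mv y k j s).
  by apply: dominated_mv_linked => // lk; rewrite hyz /s addrC subrK; exact: dz'.
split=> //; have [kk|nk] := pselect (killed k j).
  have [lk _] := W_killed pos kk.
  suff -> : s = 0 by rewrite mv0.
  have := rz k j pos kk; have := rz' k j pos kk; have := dz k j pos lk;
    have := dz' k j pos lk.
  move: mh; rewrite /s => /dvdzP[q e]; rewrite e => h1 h2 h3 h4.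
  suff -> : q = 0 by rewrite mul0r.
  nia.
move: mh dy' => /dvdzP[q ->]; rewrite mulrC => dy'.
by rewrite -[X in X - _](subrK (T y)) -addrA; apply: submodD => //;
  exact: glued_rel_int.
Qed.

Definition divisible_links := forall i j (d : int), (1 <= i <= n)%N ->
  (1 <= j <= n.-1)%N ->
  killed n.-1 j -> v n i - v n.-1 j = d%:~R -> (m %| d)%Z.

(** Heights are cleared from row 1 upwards. At a killed position raising passes through h, ..., 1
    with h < m, none divisible by m, so no barrier blocks it; elsewhere lowering reaches a multiple
    of m, which gluing identifies with 0. *)
Lemma reach_origin S z : divisible_links ->
  (forall x, submod_set M x -> submod_set N x -> submod_set S x) ->
  Lam z -> dominated n v z -> reduced z -> submod_set S (T z) -> submod_set S (T 0).
Proof.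
move=> dvl MNS hz dz rz Sz.
suff [] : dominated n v 0 /\ submod_set S (T 0) by [].
apply: (@path_ind _ n v (upward n) (fun y => dominated n v y /\
  submod_set S (T y)) z 0 (upward_uniq n) (@mem_upward n) hz (@int_shift0 n));
    last by [].
move=> pre k j suf y eL pos hy hpre hsuf [dy Sy].
have hyz : height v y k j = height v z k j by apply: hsuf; exact: mem_head.
have [jk kn] := pos.
rewrite height0 sub0r; set h := height v z k j in hyz *.
have zb : zero_below v y k j.
  move=> l hl; have := bottom_bounds v jk => tk.
  rewrite hpre ?height0 //; apply: (upward_split eL); last by lia.
  by split; lia.
have dy' : dominated n v (mv y k j (- h)).
  by apply: dominated_mv => //; rewrite hyz subrr.
split=> //; have [kk|nk] := pselect (killed k j).
  have [lk _] := W_killed pos kk.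
  have h0 : 0 <= h by exact: dz.
  have hm : h < m%:Z by exact: rz.
  have eh : h = `|h|%N by rewrite gez0_abs.
  rewrite eh; apply: (submod_raise_chainn n_gt1 m_gt2 m_odd v_gen vA vB GT) =>
    // i ih [_ bar].
  have hi : height v (mv y k j (- i%:Z)) k j = h - i%:Z by rewrite height_mv //
    !eqxx hyz.
  have hmi : (m %| h - i%:Z)%Z.
    have [|[ek [l [d [hl vd]]]]] := barrierP n_gt1 m_gt2 m_odd (int_shift_mv v
      _ pos hy) pos lk bar.
      by rewrite hi.
    rewrite hi => hd; rewrite -[h - _](addrK d); apply: rpredB => //.
    by apply: (dvl l j d) => //; rewrite -ek.
  have ih' : i%:Z < h by rewrite eh ltz_nat.
  by have := dvdz_small_eq0 hmi; lia.
(* r completes h to a multiple of m; at an unlinked position h may be negative. *)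
have [r er] : exists r : nat, (m %| h + r%:Z)%Z.
  exists `|((- h) %% m)%Z|%N; rewrite gez0_abs; last by apply: modz_ge0; lia.
  by apply/dvdzP; exists (- ((- h) %/ m)%Z); rewrite mulNr;
    have := divz_eq (- h) m; lia.
have Sr : submod_set S (T (mv y k j r)).
  exact: (submod_lower_chainn n_gt1 m_gt2 m_odd v_gen vA vB GT).
have dr : dominated n v (mv y k j r).
  by apply: dominated_mv_linked => // lk; have := dy k j pos lk; lia.
move: er => /dvdzP[q eq].
have e : mv y k j (- h) = mv (mv y k j r) k j (m%:Z * - q).
  by rewrite mvD; congr (shift_height _ _ _ _ _); rewrite mulrN mulrC -eq; ring.
rewrite -[T _](subrK (T (mv y k j r))); apply: submodD => //.
have hr := int_shift_mv v r pos hy.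
apply: MNS; last by rewrite e; apply: glued_rel_int => //; rewrite -e.
by apply: submodB; apply: basis_in_M => //; exact: int_shift_mv.
Qed.

(** Projections cut an element of S into parts with support in one residue class each. Modulo N such
    a part is 0 or a multiple of one reduced T(y); a nonzero multiple would bring T(0) into S by
    [reach_origin]. *)
Lemma quotient_simple_of_divisible S : divisible_links ->
  (forall x, submod_set S x -> submod_set M x) ->
  (forall x, submod_set M x -> submod_set N x -> submod_set S x) ->
  (forall x, submod_set S x -> submod_set N x) \/ (forall x, submod_set M x ->
    submod_set S x).
Proof.
move=> dvl SM MNS.
have [S0|nS0] := pselect (submod_set S (T 0)).
  by right=> x; apply: submod_spanE => _ ->.
left=> x Sx; have [L sL ex] := M_supported (SM x Sx).
have [r] := ubnP (size L); elim: r => // r IH in x L sL ex Sx *.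
case: L => [|[c0 z0] L0] in sL ex *.
  by move=> _; rewrite ex /lincomb big_nil; exact: submod0.
set L := _ :: L0 in sL ex * => Lr.
pose p (y : R[i] * array) := `[< cong_upto m n.-1 z0 y.2 >].
have [|a pa] := has_projections_le m_gt2 m_odd v_gen vA vB GT (leqnn n.-1) (Z
  := map snd L) z0.
  by move=> _ /mapP[y yL ->]; have [] := sL y yL.
have eL : comb L = comb [seq u <- L | p u] + comb [seq u <- L | ~~ p u].
  by rewrite -lincomb_cat /lincomb (perm_big _ (permEl (perm_filterC p L))).
have ap : comb [seq u <- L | p u] = a *: x.
  rewrite ex /lincomb scaler_sumr big_filter big_mkcond big_seq [RHS]big_seq.
  apply: eq_bigr => y yL; rewrite (scC (actC GT)) pa ?map_f // /p.
  by case: ifP => // _; rewrite scr0.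
have S1 : submod_set S (comb [seq u <- L | p u]) by rewrite ap; exact: submodZ.
have S2 : submod_set S (comb [seq u <- L | ~~ p u]).
  have -> : comb [seq u <- L | ~~ p u] = x - comb [seq u <- L | p u] by rewrite
    ex eL addrC addKr.
  exact: submodB.
rewrite ex eL; apply: submodD; last first.
  apply: IH (erefl _) S2 _; first by move=> y; rewrite mem_filter => /andP[_ /sL].
  (* The head of the list lies in its own class, so the remaining list is shorter. *)
  rewrite /= {1}/p /= asboolT /=; last by move=> i _ l _; rewrite subrr dvdz0.
  by rewrite size_filter; apply: leq_ltn_trans (count_size _ _) _; exact: Lr.
have sp y : y \in [seq u <- L | p u] -> [/\ Lam y.2, dominated n v y.2 &
  cong_upto m n.-1 z0 y.2].
  by rewrite mem_filter => /andP[/asboolP cy /sL[]].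
have [[y [yL ry]]|nex] := pselect (exists y, y \in [seq u <- L | p u] /\
  reduced y.2); last first.
  rewrite /lincomb big_seq; apply: submod_sum => y yL; apply: submodZ.
  have [hy dy _] := sp y yL; apply: not_reduced_N => // ry.
  by apply: nex; exists y.
have [hy dy cy] := sp y yL.
(* The total coefficient of the reduced terms: modulo N each of them equals T(y), and the other
   terms vanish. *)
pose lam := \sum_(u <- [seq u <- L | p u] | `[< reduced u.2 >]) u.1.
have NL : submod_set N (comb [seq u <- L | p u] - sc lam (T y.2)).
  rewrite /lam (sc_suml (actC GT)) [X in _ - X]big_mkcond -sumrB big_seq.
  apply: submod_sum => u uL; have [hu du cu] := sp u uL.
  case: asboolP => ru; last by rewrite subr0; apply: submodZ; exact: not_reduced_N.
  rewrite -scalerBr; apply: submodZ; apply: congruent_rel => //.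
  by apply: (@cong_upto_trans m _ _ z0) => //; exact: cong_uptoC.
have [l0|l0] := eqVneq lam 0.
  by move: NL; rewrite l0 (sc0 (actC GT)) subr0.
case: nS0; apply: (reach_origin dvl MNS hy dy ry).
have Ssc : submod_set S (sc lam (T y.2)).
  rewrite -[sc _ _](subKr (comb [seq u <- L | p u])); apply: submodB => //.
  by apply: MNS NL; apply: submodB; [exact: SM | apply: submodZ; exact: basis_in_M].
have -> : T y.2 = cst lam^-1 *: sc lam (T y.2).
  by rewrite -[RHS]/(sc _ _) (scA (actC GT)) mulVf // (sc1 (actC GT)).
exact: submodZ.
Qed.

(** If m does not divide d, there is a second barrier at height r = -d mod m, with 0 < r < m. The
    span of the arrays above it, enlarged by N and intersected with M, is neither inside N nor all
    of M. *)
Lemma divisible_of_quotient_simple :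
  (forall S, (forall x, submod_set S x -> submod_set M x) ->
    (forall x, submod_set M x -> submod_set N x -> submod_set S x) ->
    (forall x, submod_set S x -> submod_set N x) \/
    (forall x, submod_set M x -> submod_set S x)) -> divisible_links.
Proof.
move=> simple i j d hi hj kj vd; apply/idP/contraT => nmd; exfalso.
have pos : position n.-1 n.-1 j by split.
have [lk _] := W_killed pos kj.
pose r := ((- d) %% m)%Z.
have r_ge0 : 0 <= r by apply: modz_ge0; lia.
have rm : r < m%:Z by apply: ltz_mod; lia.
have mrd : (m %| r + d)%Z.
  by apply/dvdzP; exists (- ((- d) %/ m)%Z); rewrite mulNr /r;
    have := divz_eq (- d) m; lia.
have r_gt0 : 0 < r.
  rewrite lt_neqAle r_ge0 andbT; apply: contra nmd => /eqP r0.
  by move: mrd; rewrite -r0 add0r.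
(* Below height r the arrow raising z at (n-1, j) is cut off. *)
pose Q z := dominated n v z /\ r <= height v z n.-1 j.
have Q_stable : stable n m v Q.
  move=> z k l hz [dz rz] pl.
  have [sE sF] := dominated_stable n_gt1 m_gt2 m_odd hz dz pl.
  have nn : n.-1.+1 = n by lia.
  have [_ kn] := pl.
  have zn : delta k l n j = 0 by rewrite /delta gtn_eqF //; lia.
  split=> nz; split; [exact: sE | | exact: sF | ].
    move: rz; rewrite !height_linked // nn.
    rewrite -[(z + _) n j]/(z n j + delta k l n j) zn.
    rewrite -[(z + _) n.-1 j]/(z n.-1 j + delta k l n.-1 j) => rz.
    have [/andP[/eqP ek /eqP el]|nkl] := boolP ((n.-1 == k) && (j == l));
      last first.
      by rewrite /delta (negPf nkl); lia.
    have -> : delta k l n.-1 j = 1 by rewrite /delta ek el !eqxx.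
    suff /eqP : r != z n j - z n.-1 j by lia.
    apply: contraNneq nz => er; rewrite -ek -el.
    rewrite (coefE_top m_gt2 m_odd n_gt1 hz hi hj vd) //.
    move: er mrd; rewrite [z n j]hz; last by case; lia.
    by move=> -> h; rewrite -rpredN; congr (_ %| _)%Z : h; ring.
  rewrite height_linked // nn.
  rewrite -[(z - _) n j]/(z n j - delta k l n j) zn.
  rewrite -[(z - _) n.-1 j]/(z n.-1 j - delta k l n.-1 j).
  move: rz; rewrite height_linked // nn /delta; lia.
pose SQ := span_stable m_gt2 m_odd GT Q_stable.
have S_sub : is_submod [set x | submod_set M x /\
  submod_set (addsm SQ N) x]%classic.
  split=> [|a x y [Mx Ax] [My Ay]]; first by split; exact: submod0.
  by split; apply: submodD => //; exact: submodZ.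
have SQ_basis z : Lam z -> Q z -> submod_set SQ (T z).
  move=> hz Qz; exists [:: (1, z)]; first exact: supported_basis.
  by rewrite /lincomb big_seq1 /= (sc1 (actC GT)).
case: (simple (Submod S_sub)) => [x []//|x Mx Nx|SN|MS].
- by split=> //; exists 0; [exact: submod0 | exists x => //; rewrite add0r].
(* This z has height r at (n-1, j) and 0 elsewhere. All heights are below m, so T(z) lies in the
   submodule but not in N. *)
- pose z := mv 0 n.-1 j r.
  have hz : Lam z by apply: int_shift_mv => //; exact: int_shift0.
  have dz : dominated n v z by apply: dominated_mv; rewrite ?height0 ?add0r //;
    exact: dominated0.
  have zr a b : (1 <= b <= a)%N -> height v z a b =
    if (a == n.-1) && (b == j) then r else 0.
    by move=> ba; rewrite height_mv // height0 add0r.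
  apply: (basis_notin_N hz) => [k l [kl _]|].
    by rewrite zr //; case: ifP => // _; lia.
  apply: SN; split; first exact: basis_in_M.
  exists (T z); last by exists 0; rewrite ?addr0 //; exact: submod0.
  by apply: SQ_basis => //; split=> //; rewrite zr ?eqxx //; case: pos.
(* The functional of the zero class is 1 at T(0) but vanishes on N and on the span: the heights
   there are at least r > 0 at the killed position, where the class requires exactly 0. *)
- have [] : submod_set M (T 0) /\ submod_set (addsm SQ N) (T 0) := MS (T 0)
  (@submod_span1 _ _ _).
  move=> _ [y SQy [w Nw eyw]].
  have := class_sum_basis (fun _ _ => 0) (@int_shift0 n).
  rewrite asboolT; last by move=> k l _; rewrite height0 subrr dvdz0.
  rewrite -eyw /class_sum (coordsumD (actC GT) _ (act_free GT)).
  rewrite -/(class_sum _ w) (class_sum_N _ Nw); last by move=> _ _; lia.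
  have [L sL ->] := SQy.
  rewrite (coordsum_lincomb (actC GT) _ (act_free GT)); last by move=> p /sL[].
  rewrite /evalcomb big_seq big1 => [|p /sL[_ [_ rp]]];
    first by rewrite add0r => /esym/eqP; rewrite oner_eq0.
  rewrite asboolF ?mulr0 // => /(_ n.-1 j pos)[/(_ kj) e _].
  by move: rp; rewrite e; lia.
Qed.
End Quotient.

(** * Simplicity of a subquotient *)

Section SimpleSubquotient.
Local Open Scope quotient_scope.
Variables (A : pzRingType) (V : lmodType A) (M N : submod V).
Local Notation q := (fun u => \pi_(quot_mod (restrict_submod M N)) u : subquot M N).

Lemma subquot_piP a u w : q (a *: u + w) = a *: q u + q w.
Proof.
rewrite -[a *: q u]/(quot_scale a (q u)) quot_scale_pi.
exact: Quotient.pi_add.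
Qed.

Lemma subquot_surj (y : subquot M N) : exists u, y = q u.
Proof. by exists (repr y); rewrite reprK. Qed.

Lemma subquot_pi0 : q 0 = 0.
Proof.
by apply: (addrI (1 *: q 0)); rewrite -subquot_piP scale1r !addr0 scale1r.
Qed.

Lemma subquot_eq0 u : q u = 0 <-> submod_set N (val u).
Proof.
rewrite -subquot_pi0.
have e : (u - 0 \in submod_pred (restrict_submod M N)) =
    (u == 0 %[mod quot_mod (restrict_submod M N)]) := Quotient.idealrBE _ u 0.
rewrite subr0 in e.
split=> [/eqP|h]; first by rewrite -e => /set_mem.
by apply/eqP; rewrite -e; apply/mem_set.
Qed.

Lemma subquot_lift x : submod_set M x -> exists u : submod_type M, val u = x.
Proof. by move=> Mx; exists (exist _ x (mem_set Mx)). Qed.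

Lemma submod_valP (u : submod_type M) : submod_set M (val u).
Proof. exact: (set_mem (valP u)). Qed.

(** Submodules of the subquotient correspond to those S inside M that contain the intersection of M
    and N: take images under q for one implication and preimages for the other. *)
Lemma simple_subquotP : simple_module (subquot M N) <->
  (exists2 x, submod_set M x & ~ submod_set N x) /\
  (forall S : submod V, (forall x, submod_set S x -> submod_set M x) ->
    (forall x, submod_set M x -> submod_set N x -> submod_set S x) ->
    (forall x, submod_set S x -> submod_set N x) \/
    (forall x, submod_set M x -> submod_set S x)).
Proof.
split=> [[[y y0] simple]|[[x Mx Nx] simple]].
  split.
    have [u yu] := subquot_surj y; exists (val u); first exact: submod_valP.
    by move=> /subquot_eq0 qu; move: y0; rewrite yu qu eqxx.
  move=> S SM MNS.
  have img : is_submod [set q u | u in [set u | submod_set S (val u)]]%classic.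
    split=> [|a _ _ [u Su <-] [w Sw <-]].
      by exists 0; [rewrite /mkset raddf0; exact: submod0 | exact: subquot_pi0].
    exists (a *: u + w); last exact: subquot_piP.
    by rewrite /mkset linearP; apply: submodD => //; exact: submodZ.
  have [e0|eT] := simple (Submod img); [left=> x Sx|right=> x Mx].
    have [u ux] := subquot_lift (SM x Sx).
    have : submod_set (Submod img) (q u) by exists u; rewrite //= ux.
    by rewrite e0 => /subquot_eq0; rewrite ux.
  have [u ux] := subquot_lift Mx.
  have : submod_set (Submod img) (q u) by rewrite eT.
  case=> w Sw qwu.
  have : q (- 1 *: w + u) = 0.
    by rewrite subquot_piP scaleN1r qwu addNr.
  have e : val (- 1 *: w + u) = val u - val w by rewrite linearP scaleN1r addrC.
  move=> /subquot_eq0; rewrite e ux => Nuw.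
  rewrite -[x](subrK (val w)); apply: submodD => //.
  by apply: MNS => //; apply: submodB => //; exact: submod_valP.
split.
  have [u ux] := subquot_lift Mx; exists (q u); apply/eqP => /subquot_eq0.
  by rewrite ux.
move=> S.
have pre : is_submod [set x | exists2 u : submod_type M, val u =
  x & submod_set S (q u)]%classic.
  split=> [|a _ _ [u <- Su] [w <- Sw]].
    by exists 0; [exact: raddf0 | rewrite subquot_pi0; exact: submod0].
  exists (a *: u + w); first exact: linearP.
  by rewrite subquot_piP; apply: submodD => //; exact: submodZ.
case: (simple (Submod pre)) => [z [u <- _]|z Mz Nz|SN|MS].
- exact: submod_valP.
- have [u uz] := subquot_lift Mz; exists u => //.
  suff -> : q u = 0 by exact: submod0.
  by apply/subquot_eq0; rewrite uz.
- left; apply/seteqP; split=> [y Sy|_ ->]; last exact: submod0.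
  have [u yu] := subquot_surj y; rewrite /= yu; apply/subquot_eq0.
  by apply: SN; exists u; rewrite // -yu.
- right; apply/seteqP; split=> // y _.
  have [u yu] := subquot_surj y; rewrite yu.
  have [w wu Sw] := MS (val u) (submod_valP u).
  by have -> : u = w by apply: val_inj.
Qed.
End SimpleSubquotient.

Section SumOfSubmodules.
Variables (A : pzRingType) (V : lmodType A) (I : eqType) (r : seq I) (F : I ->
  submod V).
Local Notation total := (\big[@addsm _ V/@zerosm _ V]_(i <- r) F i).

Lemma big_addsm_sub i x : i \in r -> submod_set (F i) x -> submod_set total x.
Proof.
elim: r => // j s IH; rewrite inE big_cons => /orP[/eqP <-|/IH h] Fx.
  by exists x => //; exists 0; [exact: submod0 | rewrite addr0].
by exists 0; [exact: submod0 | exists x; [exact: h | rewrite add0r]].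
Qed.

Lemma big_addsm_ind (P : V -> Prop) : P 0 -> (forall x y, P x -> P y ->
  P (x + y)) ->
  (forall i x, i \in r -> submod_set (F i) x -> P x) ->
  forall x, submod_set total x -> P x.
Proof.
move=> P0 PD; elim: r => [|j s IH] PF x.
  by rewrite big_nil => ->.
rewrite big_cons => -[y Fy [z Fz <-]]; apply: PD.
  by apply: (PF j) => //; exact: mem_head.
by apply: IH Fz => i w si; apply: PF; rewrite inE si orbT.
Qed.
End SumOfSubmodules.

(** This yields the action of K_j^-1, on which the Gelfand-Tsetlin formulae are silent. *)
Lemma left_inverse_action (K : fieldType) (A : pzRingType) (cst : K ->
  A) (V : lmodType A)
    (a b : A) (c : K) (x : V) : central_scalars cst -> a * b = 1 -> c != 0 ->
  b *: x = scal cst c x -> a *: x = scal cst c^-1 x.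
Proof.
move=> cstP ab c0 bx; have : scal cst c^-1 (a *: (b *: x)) = scal cst c^-1 x.
  by rewrite scalerA ab scale1r.
by rewrite bx (scC cstP) (scA cstP) mulVf // (sc1 cstP).
Qed.

(** * The quantum group action and the theorem *)

Section Instantiation.
Variables (R : realType) (n m : nat) (v : nat -> nat -> R[i]).
Variables (V : lmodType (Uq n (qroot R m))) (T : array -> V).
Hypothesis GT : is_GT_module v T.
Local Notation rel := (@Uq_rel _ n (qroot R m)).

Lemma GT_Kinv z (k : 'I_n) : int_shift n z ->
  UKinv (qroot R m) k *: T z =
    kscale (qpow m (weight (translate v z) k.+1))^-1 (T z).
Proof.
move=> hz.
have KK : UKinv (qroot R m) k * UK (qroot R m) k = 1.
  have e := pres_piM rel << fmu (GKinv k) >> << fmu (GK k) >>.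
  by rewrite -[LHS]/(_ * _) -[LHS]e; apply/pres_pi_rel/rel_KinvK.
exact: (left_inverse_action (pres_const_central rel) KK (qpow_neq0 m _) (GT_K
  GT k hz)).
Qed.

Lemma GT_action_of_module : GT_action n m v (pres_const rel) T.
Proof.
have [spanT freeT] := GT_basis GT.
split.
- exact: pres_const_central.
- exact: spanT.
- exact: freeT.
- case=> // k kn; exists (UE (qroot R m) (Ordinal (kn : (k < n.-1)%N))) => z hz.
  exact: (GT_E GT (Ordinal (kn : (k < n.-1)%N)) hz).
- case=> // k kn; exists (UF (qroot R m) (Ordinal (kn : (k < n.-1)%N))) => z hz.
  exact: (GT_F GT (Ordinal (kn : (k < n.-1)%N)) hz).
- case=> // k kn; exists (UK (qroot R m) (Ordinal (kn : (k < n)%N))) => z hz.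
  exact: (GT_K GT (Ordinal (kn : (k < n)%N)) hz).
move=> P Pc PE PF PK PKi PD PM; apply: pres_ind => //; case=> k.
- by apply: (PE k.+1) => [|z hz]; [exact: (ltn_ord k) | exact: (GT_E GT k hz)].
- by apply: (PF k.+1) => [|z hz]; [exact: (ltn_ord k) | exact: (GT_F GT k hz)].
- by apply: (PK k.+1) => [|z hz]; [exact: (ltn_ord k) | exact: (GT_K GT k hz)].
- by apply: (PKi k.+1) => [|z hz]; [exact: (ltn_ord k) | exact: (GT_Kinv k hz)].
Qed.
End Instantiation.

Lemma big_row_sum (A : pzRingType) (V : lmodType A) (n : nat) (W : nat ->
  nat -> submod V) :
  let N := \big[@addsm _ V/@zerosm _ V]_(1 <= k < n)
    \big[@addsm _ V/@zerosm _ V]_(1 <= j < k.+1) W k j in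
  (forall k j x, position n.-1 k j -> submod_set (W k j) x -> submod_set N x) /\
  (forall P : V -> Prop, P 0 -> (forall x y, P x -> P y -> P (x + y)) ->
    (forall k j x, position n.-1 k j -> submod_set (W k j) x -> P x) ->
    forall x, submod_set N x -> P x).
Proof.
split=> [k j x [jk kn] Wx|P P0 PD PW].
  apply: (@big_addsm_sub _ _ _ _ _ k); first by rewrite mem_index_iota; lia.
  by apply: (@big_addsm_sub _ _ _ _ _ j) => //; rewrite mem_index_iota.
apply: big_addsm_ind => // k x; rewrite mem_index_iota => kn.
apply: big_addsm_ind => // j {}x; rewrite mem_index_iota => jk.
by apply: PW; split; lia.
Qed.

Theorem theorem3p8 (R : realType) (n m : nat) (v : nat -> nat -> R[i])
    (V : lmodType (Uq n (qroot R m))) (T : (nat -> nat -> int) -> V)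
    (W : nat -> nat -> submod V) :
  (2 <= n)%N -> (3 <= m)%N -> odd m ->
  generic n v -> conventionA n v -> conventionB n v ->
  is_GT_module v T -> W_choice v T W ->
  simple_module (Vbar T W) <->
  (forall i j : nat, (1 <= i <= n)%N -> (1 <= j <= n.-1)%N ->
     W n.-1 j = W2 v T n.-1 j ->
     forall d : int, v n i - v n.-1 j = d%:~R -> (m %| d)%Z).
Proof.
move=> n2 m3 m_odd v_gen vA vB /GT_action_of_module GT Wch.
(* Linkedness is part of [killed] because the equality of W with W2 does not by itself assert it. *)
pose killed k j := v k.+1 j = v k j /\ W k j = W2 v T k j.
have W_glued k j : position n.-1 k j -> ~ killed k j -> W k j = W1 v T k j.
  move=> pos nk; have [h1 h2] := Wch k j pos.
  by have [e|/h1 //] := pselect (v k.+1 j = v k j); case: (h2 e) => // e2; case: nk.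
have W_killed k j : position n.-1 k j -> killed k j ->
    linked v k j /\ W k j = W2 v T k j.
  by move=> _ [e eW]; split=> //; exact/eqP.
have [N_W N_ind] := big_row_sum n W.
have mainr := divisible_of_quotient_simple n2 m3 m_odd v_gen vA vB GT W_glued
  W_killed N_ind.
have mainl := quotient_simple_of_divisible n2 m3 m_odd v_gen vA vB GT W_glued
  W_killed N_W.
have T0 := basis_notin_N n2 m3 m_odd GT W_glued W_killed N_ind (@int_shift0 n).
split=> [/simple_subquotP[_ simple] i j hi hj eW d vd|dvl].
  apply: (mainr simple i j d) => //; split=> //.
  (* Integrality of v_ni - v_(n-1,j) makes (n-1, j) linked, by convention (B). *)
  by apply/eqP; have := link_top m3 m_odd vB hi hj vd; rewrite /linked.
apply/simple_subquotP; split.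
  exists (T 0); first exact: submod_span1.
  by apply: T0 => // k j _; rewrite height0; lia.
move=> S SM MNS; apply: mainl => // i j d hi hj [_ eW] vd.
exact: dvl hi hj eW d vd.
Qed.
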